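(* Let $n\ge 1$ and let $X$ be a connected affine variety over $\Bbbk$. If $\operatorname{Aut}(X)\simeq\operatorname{Aut}(\mathbb A^n)$ as ind-groups, then $X\simeq\mathbb A^n$ as varieties.
   Context: The base field $\Bbbk$ is algebraically closed of characteristic zero; varieties are reduced, not necessarily irreducible, algebraic varieties over $\Bbbk$, and $\mathbb A^n=\Bbbk^n$ is affine $n$-space. An ind-variety is a set $\mathcal V$ with an ascending filtration $\mathcal V_0\subseteq\mathcal V_1\subseteq\cdots$, $\mathcal V=\bigcup_k\mathcal V_k$, such that each $\mathcal V_k$ is an algebraic variety and $\mathcal V_k$ is Zariski-closed (a closed subvariety) in $\mathcal V_{k+1}$. A morphism $\phi:\mathcal V\to\mathcal W$ of ind-varieties is a map such that for every $k$ there is an $m$ with $\phi(\mathcal V_k)\subseteq\mathcal W_m$ and $\mathcal V_k\to\mathcal W_m$ a morphism of varieties. An ind-group is an ind-variety with a group structure such that multiplication and inversion are morphisms of ind-varieties; homomorphisms (isomorphisms) of ind-groups are group homomorphisms (isomorphisms) that are morphisms (isomorphisms) of ind-varieties. For an affine variety $X$ the group $\operatorname{Aut}(X)$ of automorphisms of the variety $X$ is an ind-group as follows: for a closed embedding $X\subseteq\mathbb A^m$, $\operatorname{End}(X)$ is identified with a closed subset of $\mathcal O(X)^m$, where $\mathcal O(X)$ is filtered by finite-dimensional subspaces, and $\operatorname{Aut}(X)$ is identified with the closed subset $\{(\alpha,\beta)\mid\alpha\circ\beta=\beta\circ\alpha=\operatorname{id}\}\subseteq\operatorname{End}(X)\times\operatorname{End}(X)$;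 up to equivalence of filtrations this does not depend on the choices. *)

(* Defs.v *)
From HB Require Import structures.
From mathcomp Require Import all_boot all_algebra.
From mathcomp Require Import boolp classical_sets functions.
From mathcomp Require Import mpoly.

Set Implicit Arguments.
Unset Strict Implicit.
Unset Printing Implicit Defensive.

Import GRing.Theory.

Local Open Scope classical_set_scope.
Local Open Scope ring_scope.


Section ZariskiClosed.
Variables (k : fieldType) (m : nat).

Definition zariski_closed (X : set 'rV[k]_m) : Prop :=
  exists I : set {mpoly k[m]},
    X = [set x | forall p, I p -> p.@[x 0] = 0].

Lemma zariski_closedT : zariski_closed [set: 'rV[k]_m].
Proof. by exists set0; apply/seteqP; split => [x _ p|x]. Qed.

(* The empty set counts as connected. *)
Definition zariski_connected (X : set 'rV[k]_m) : Prop :=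
  forall Y Z : set 'rV[k]_m, zariski_closed Y -> zariski_closed Z ->
    X = Y `|` Z -> Y `&` Z = set0 -> Y = set0 \/ Z = set0.

End ZariskiClosed.

Record affine_variety (k : fieldType) := AffineVariety {
  ambient_dim : nat;
  locus :> set 'rV[k]_ambient_dim;
  locus_closed : zariski_closed locus }.

Arguments locus {k} X _ : rename.

Definition affine_space (k : fieldType) (n : nat) : affine_variety k :=
  AffineVariety (@zariski_closedT k n).

Section VarietyMorphisms.
Variable k : fieldType.

(* The points of [X] are the elements of the type [{x | x \in locus X}], to
   which [X] coerces. *)
Definition is_morphism (X Y : affine_variety k) (phi : X -> Y) : Prop :=
  exists P : 'I_(ambient_dim Y) -> {mpoly k[ambient_dim X]},
    forall (x : X) j, val (phi x) 0 j = (P j).@[val x 0].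

Definition variety_iso (X Y : affine_variety k) : Prop :=
  exists (phi : X -> Y) (psi : Y -> X),
    [/\ is_morphism phi, is_morphism psi, cancel phi psi & cancel psi phi].

Lemma is_morphism_id (X : affine_variety k) : is_morphism (@id X).
Proof. by exists (fun j => 'X_j) => x j; rewrite mevalXU. Qed.

Lemma is_morphism_comp (X Y Z : affine_variety k) (psi : Y -> Z) (phi : X -> Y) :
  is_morphism psi -> is_morphism phi -> is_morphism (psi \o phi).
Proof.
move=> [Q hQ] [P hP]; exists (fun j => Q j \mPo [tuple P i | i < _]) => x j.
rewrite /= hQ comp_mpoly_meval; apply: meval_eq => i.
by rewrite tnth_mktuple hP.
Qed.

End VarietyMorphisms.


Section FunctionAlgebras.
Variables (k : fieldType) (V : Type).
Implicit Types (R L : set (V -> k)).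

Definition is_subalgebra R : Prop :=
  [/\ forall c, R (cst c),
      forall f g, R f -> R g -> R (f \+ g)
    & forall f g, R f -> R g -> R (f \* g)].

Definition generated_algebra L : set (V -> k) := smallest is_subalgebra L.

Lemma generated_algebra_subalg L : is_subalgebra (generated_algebra L).
Proof.
split.
- by move=> c R [[Rc _ _] _]; apply: Rc.
- by move=> f g hf hg R RP; have [[_ RD _] _] := RP; apply: RD; [apply: hf|apply: hg].
- by move=> f g hf hg R RP; have [[_ _ RM] _] := RP; apply: RM; [apply: hf|apply: hg].
Qed.

Lemma generated_algebra_gen L : L `<=` generated_algebra L.
Proof. by move=> f Lf R [_]; apply. Qed.

Lemma generated_algebra_ind L R :
  is_subalgebra R -> L `<=` R -> generated_algebra L `<=` R.
Proof. by move=> RA LR f; apply. Qed.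

Lemma subalgebra_sum R (I : Type) (r : seq I) (F : I -> V -> k) :
  is_subalgebra R -> (forall i, R (F i)) -> R (fun v => \sum_(i <- r) F i v).
Proof.
move=> [Rc RD _] RF; elim: r => [|i r IHr].
  by rewrite (_ : (fun _ => _) = cst 0) //; apply/funext => v; rewrite big_nil.
rewrite (_ : (fun _ => _) = F i \+ (fun v => \sum_(i <- r) F i v)); first exact: RD.
by apply/funext => v; rewrite big_cons.
Qed.

Lemma subalgebra_prod R (I : Type) (r : seq I) (F : I -> V -> k) :
  is_subalgebra R -> (forall i, R (F i)) -> R (fun v => \prod_(i <- r) F i v).
Proof.
move=> [Rc _ RM] RF; elim: r => [|i r IHr].
  by rewrite (_ : (fun _ => _) = cst 1) //; apply/funext => v; rewrite big_nil.
rewrite (_ : (fun _ => _) = F i \* (fun v => \prod_(i <- r) F i v)); first exact: RM.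
by apply/funext => v; rewrite big_cons.
Qed.

Lemma subalgebra_meval R n (h : 'I_n -> V -> k) (p : {mpoly k[n]}) :
  is_subalgebra R -> (forall i, R (h i)) -> R (fun v => p.@[h^~ v]).
Proof.
move=> RA Rh; have [Rc _ RM] := RA.
rewrite (_ : (fun _ => _) =
    fun v => \sum_(mu <- msupp p) (cst p@_mu \* fun v => \prod_i h i v ^+ mu i) v).
  apply: subalgebra_sum => // mu; apply: (RM) => //.
  apply: subalgebra_prod => // i.
  elim: (mu i) => [|e IHe].
    by rewrite (_ : (fun _ => _) = cst 1).
  rewrite (_ : (fun _ => _) = h i \* (fun v => h i v ^+ e)); first exact: RM.
  by apply/funext => v; rewrite exprS.
by apply/funext => v; rewrite mevalE.
Qed.

(* Polynomials in the coordinates of [e], as functions on [S]. *)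
Definition chart_functions n (S : set V) (e : V -> 'rV[k]_n) : set (V -> k) :=
  [set f | exists p : {mpoly k[n]}, forall v, S v -> f v = p.@[e v 0]].

Lemma chart_functions_subalg n (S : set V) (e : V -> 'rV[k]_n) :
  is_subalgebra (chart_functions S e).
Proof.
split.
- by move=> c; exists c%:MP => v _; rewrite mevalC.
- move=> f g [p hp] [q hq]; exists (p + q) => v Sv.
  by rewrite mevalD /= hp ?hq.
- move=> f g [p hp] [q hq]; exists (p * q) => v Sv.
  by rewrite mevalM /= hp ?hq.
Qed.

Lemma chart_functions_coord n (S : set V) (e : V -> 'rV[k]_n) i :
  chart_functions S e (fun v => e v 0 i).
Proof. by exists 'X_i => v _; rewrite mevalXU. Qed.

Lemma eq_chart_functions n (S : set V) (e : V -> 'rV[k]_n) f g :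
  (forall v, S v -> f v = g v) -> chart_functions S e f -> chart_functions S e g.
Proof. by move=> fg [p hp]; exists p => v Sv; rewrite -fg ?hp. Qed.

End FunctionAlgebras.

Section ClosedByFunctions.
Variables (k : fieldType) (n : nat).

Lemma zariski_closed_functions (Z : set 'rV[k]_n) (J : set ('rV[k]_n -> k)) :
  (forall f, J f -> chart_functions setT id f) ->
  (forall c, Z c <-> forall f, J f -> f c = 0) -> zariski_closed Z.
Proof.
move=> Jpoly ZJ.
exists [set p | exists2 f, J f & forall c, f c = p.@[c 0]].
apply/seteqP; split => [c Zc p [f Jf fp]|c /= hc].
  by rewrite -fp; move/ZJ: Zc; apply.
apply/ZJ => f Jf; have [p hp] := Jpoly f Jf.
by rewrite hp //; apply: hc; exists f => // c'; rewrite hp.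
Qed.

Lemma zariski_closed_poly (Z : set 'rV[k]_n) (c : 'rV[k]_n) :
  zariski_closed Z ->
  Z c <-> forall q, (forall z, Z z -> q.@[z 0] = 0) -> q.@[c 0] = 0.
Proof.
move=> [I ->]; split=> [Zc q|hc q Iq]; first exact.
by apply: hc => z; apply.
Qed.

End ClosedByFunctions.


Section AffineStructures.
Variables (k : fieldType) (V : Type).

(* [R] consists of the functions on [V] whose restriction to the subset [S] is
   regular; the axiom says that [S] with these functions is isomorphic to a
   Zariski-closed subset of an affine space with its polynomial functions. *)
Definition is_affine_structure (S : set V) (R : set (V -> k)) : Prop :=
  exists (n : nat) (e : V -> 'rV[k]_n),
    [/\ forall u v, S u -> S v -> e u = e v -> u = v,
        zariski_closed (e @` S)
      & forall f, R f <->
          exists p : {mpoly k[n]}, forall v, S v -> f v = p.@[e v 0]].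

Definition is_closed_subvariety (S : set V) (R : set (V -> k))
    (S' : set V) (R' : set (V -> k)) : Prop :=
  (exists2 I : set (V -> k), I `<=` R'
     & S = S' `&` [set v | forall f, I f -> f v = 0]) /\
  (forall f, R f <-> exists2 f', R' f' & forall v, S v -> f v = f' v).

End AffineStructures.

(* All filtration pieces are affine: this is the only case occurring for
   automorphism groups of affine varieties. *)
Record ind_structure (k : fieldType) (V : Type) := IndStructure {
  ind_fil : nat -> set V;
  ind_reg : nat -> set (V -> k);
  ind_exhaustive : forall v, exists d, ind_fil d v;
  ind_affine : forall d, is_affine_structure (ind_fil d) (ind_reg d);
  ind_closed : forall d, is_closed_subvariety
    (ind_fil d) (ind_reg d) (ind_fil d.+1) (ind_reg d.+1) }.

Definition is_ind_morphism (k : fieldType) (V W : Type)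
    (sV : ind_structure k V) (sW : ind_structure k W) (phi : V -> W) : Prop :=
  forall d, exists e,
    (forall v, ind_fil sV d v -> ind_fil sW e (phi v)) /\
    (forall f, ind_reg sW e f -> ind_reg sV d (f \o phi)).

Section IndProduct.
Variables (k : fieldType) (V W : Type).
Variables (sV : ind_structure k V) (sW : ind_structure k W).

Definition prod_fil (d : nat) : set (V * W) := ind_fil sV d `*` ind_fil sW d.

(* The tensor product of the two algebras of regular functions. *)
Definition prod_reg (d : nat) : set (V * W -> k) :=
  [set f | exists2 F,
     generated_algebra ([set g \o fst | g in ind_reg sV d] `|`
                        [set g \o snd | g in ind_reg sW d]) F
   & forall v, prod_fil d v -> f v = F v].

Lemma ind_fil_le (T : Type) (s : ind_structure k T) d e :
  (d <= e)%N -> ind_fil s d `<=` ind_fil s e.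
Proof.
elim: e => [|e IHe]; first by rewrite leqn0 => /eqP ->.
rewrite leq_eqVlt => /orP[/eqP -> //|/IHe de] v /de.
by have [[I _ ->] _] := ind_closed s e => -[].
Qed.

Lemma ind_reg_subalg (T : Type) (s : ind_structure k T) d :
  is_subalgebra (ind_reg s d).
Proof.
have [n [e [_ _ he]]] := ind_affine s d.
rewrite (_ : ind_reg s d = chart_functions (ind_fil s d) e).
  exact: chart_functions_subalg.
by apply/seteqP; split => f /he.
Qed.

Lemma prod_exhaustive v : exists d, prod_fil d v.
Proof.
case: v => v w.
have [d hd] := ind_exhaustive sV v; have [e he] := ind_exhaustive sW w.
exists (maxn d e); split => /=.
  exact: ind_fil_le (leq_maxl d e) _ hd.
exact: ind_fil_le (leq_maxr d e) _ he.
Qed.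

Lemma prod_reg_subalg d : is_subalgebra (prod_reg d).
Proof.
have [Gc GD GM] := generated_algebra_subalg
  ([set g \o fst | g in ind_reg sV d] `|` [set g \o snd | g in ind_reg sW d]).
split.
- by move=> c; exists (cst c).
- move=> f g [F hF fF] [G hG gG]; exists (F \+ G); first exact: GD.
  by move=> v hv; rewrite /= fF // gG.
- move=> f g [F hF fF] [G hG gG]; exists (F \* G); first exact: GM.
  by move=> v hv; rewrite /= fF // gG.
Qed.

Lemma prod_reg_fst d f : ind_reg sV d f -> prod_reg d (f \o fst).
Proof.
by exists (f \o fst) => //; apply: generated_algebra_gen; left; exists f.
Qed.

Lemma prod_reg_snd d f : ind_reg sW d f -> prod_reg d (f \o snd).
Proof.
by exists (f \o snd) => //; apply: generated_algebra_gen; right; exists f.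
Qed.

Lemma eq_prod_reg d f g : (forall v, prod_fil d v -> f v = g v) ->
  prod_reg d f -> prod_reg d g.
Proof. by move=> fg [F hF fF]; exists F => // v hv; rewrite -fg ?fF. Qed.

Lemma prod_affine d : is_affine_structure (prod_fil d) (prod_reg d).
Proof.
have [n1 [e1 [inj1 cl1 r1]]] := ind_affine sV d.
have [n2 [e2 [inj2 cl2 r2]]] := ind_affine sW d.
pose e (v : V * W) := row_mx (e1 v.1) (e2 v.2).
have coord1 v i : e v 0 (lshift n2 i) = e1 v.1 0 i by rewrite row_mxEl.
have coord2 v i : e v 0 (rshift n1 i) = e2 v.2 0 i by rewrite row_mxEr.
exists (n1 + n2)%N, e; split.
- move=> [u1 u2] [v1 v2] [/= h1 h2] [/= h3 h4] /eq_row_mx[/= E1 E2].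
  by congr pair; [apply: inj1|apply: inj2].
- pose J := [set f | (exists2 q : {mpoly k[n1]},
       (forall z, (e1 @` ind_fil sV d) z -> q.@[z 0] = 0)
       & f = fun c : 'rV[k]_(n1 + n2) => q.@[fun i => c 0 (lshift n2 i)]) \/
     (exists2 q : {mpoly k[n2]},
       (forall z, (e2 @` ind_fil sW d) z -> q.@[z 0] = 0)
       & f = fun c : 'rV[k]_(n1 + n2) => q.@[fun i => c 0 (rshift n1 i)])].
  apply: (@zariski_closed_functions k _ _ J) => [f|c].
    by case=> -[q _ ->]; apply: subalgebra_meval;
       [exact: chart_functions_subalg|move=> i; apply: chart_functions_coord
       |exact: chart_functions_subalg|move=> i; apply: chart_functions_coord].
  split=> [[[v w] [/= Sv Sw] <-] f [] [q hq ->]|hJ].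
  + rewrite -[RHS](hq (e1 v)); last by exists v.
    by apply: meval_eq => i; rewrite coord1.
  + rewrite -[RHS](hq (e2 w)); last by exists w.
    by apply: meval_eq => i; rewrite coord2.
  have [v Sv ev] : (e1 @` ind_fil sV d) (lsubmx c).
    apply/(zariski_closed_poly _ cl1) => q hq.
    rewrite -[RHS](hJ (fun c => q.@[fun i => c 0 (lshift n2 i)])).
      by apply: meval_eq => i; rewrite mxE.
    by left; exists q.
  have [w Sw ew] : (e2 @` ind_fil sW d) (rsubmx c).
    apply/(zariski_closed_poly _ cl2) => q hq.
    rewrite -[RHS](hJ (fun c => q.@[fun i => c 0 (rshift n1 i)])).
      by apply: meval_eq => i; rewrite mxE.
    by right; exists q.
  by exists (v, w); rewrite // /e /= ev ew hsubmxK.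
- move=> f; split.
  + case=> F hF fF.
    apply: (@eq_chart_functions _ _ _ _ e F) => [v hv|]; first by rewrite fF.
    move: F hF {f fF}; apply: generated_algebra_ind.
      exact: chart_functions_subalg.
    move=> _ [] [g /[swap] <-].
      move=> /r1[p hp].
      apply: (@eq_chart_functions _ _ _ _ _
               (fun v => p.@[fun i => e v 0 (lshift n2 i)])).
        move=> v [Sv _]; rewrite /= hp //.
        by apply: meval_eq => i; rewrite coord1.
      apply: subalgebra_meval; first exact: chart_functions_subalg.
      by move=> i; apply: chart_functions_coord.
    move=> /r2[p hp].
    apply: (@eq_chart_functions _ _ _ _ _
             (fun v => p.@[fun i => e v 0 (rshift n1 i)])).
      move=> v [_ Sv]; rewrite /= hp //.
      by apply: meval_eq => i; rewrite coord2.
    apply: subalgebra_meval; first exact: chart_functions_subalg.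
    by move=> i; apply: chart_functions_coord.
  + case=> p hp; apply: (@eq_prod_reg _ (fun v => p.@[e v 0])).
      by move=> v hv; rewrite hp.
    apply: (@subalgebra_meval _ _ _ _ (fun i v => e v 0 i)).
      exact: prod_reg_subalg.
    move=> i; case: (split_ordP i) => j ->.
      under eq_fun do rewrite coord1.
      apply: (@prod_reg_fst d (fun v => e1 v 0 j)); apply/r1.
      by exists 'X_j => v _; rewrite mevalXU.
    under eq_fun do rewrite coord2.
    apply: (@prod_reg_snd d (fun v => e2 v 0 j)); apply/r2.
    by exists 'X_j => v _; rewrite mevalXU.
Qed.

Lemma prod_fil_sub d : prod_fil d `<=` prod_fil d.+1.
Proof. by move=> v [h1 h2]; split; apply: ind_fil_le (leqnSn d) _ _. Qed.

Lemma prod_closed d : is_closed_subvariety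
  (prod_fil d) (prod_reg d) (prod_fil d.+1) (prod_reg d.+1).
Proof.
have [[I1 sI1 E1] R1] := ind_closed sV d.
have [[I2 sI2 E2] R2] := ind_closed sW d.
split.
  exists ([set f \o fst | f in I1] `|` [set f \o snd | f in I2]).
    move=> _ [] [g Ig <-]; [apply: prod_reg_fst|apply: prod_reg_snd].
      exact: sI1.
    exact: sI2.
  apply/seteqP; split=> [[v w] [/= hv hw]|[v w] [[/= hv hw] hI]].
    split; first by apply: prod_fil_sub.
    move: hv hw; rewrite E1 E2 => -[_ hv] [_ hw] _ [] [g Ig <-] /=.
      exact: hv.
    exact: hw.
  split; rewrite /= ?E1 ?E2; split=> // f If.
    by apply: (hI (f \o fst)); left; exists f.
  by apply: (hI (f \o snd)); right; exists f.
move=> f; split.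
  case=> F hF fF.
  suff [F' hF' FF'] : exists2 F', prod_reg d.+1 F'
      & forall v, prod_fil d v -> F v = F' v.
    by exists F' => // v hv; rewrite fF // FF'.
  have [Sc SD SM] := prod_reg_subalg d.+1.
  move: F hF {f fF}; apply: (@generated_algebra_ind _ _ _
    [set F | exists2 F', prod_reg d.+1 F' & forall v, prod_fil d v -> F v = F' v]).
    split.
    - by move=> c; exists (cst c).
    - move=> f g [f' hf ff'] [g' hg gg']; exists (f' \+ g'); first exact: SD.
      by move=> v hv /=; rewrite ff' // gg'.
    - move=> f g [f' hf ff'] [g' hg gg']; exists (f' \* g'); first exact: SM.
      by move=> v hv /=; rewrite ff' // gg'.
  move=> _ [] [g /[swap] <-].
    move=> /R1[g' hg' gg']; exists (g' \o fst); first exact: prod_reg_fst.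
    by move=> v [hv _]; apply: gg'.
  move=> /R2[g' hg' gg']; exists (g' \o snd); first exact: prod_reg_snd.
  by move=> v [_ hv]; apply: gg'.
case=> F [F' hF' FF'] fF.
apply: (@eq_prod_reg _ F').
  by move=> v hv; rewrite fF // FF' //; apply: prod_fil_sub.
move: F' hF' {f F FF' fF}; apply: generated_algebra_ind.
  exact: prod_reg_subalg.
move=> _ [] [g hg <-]; [apply: prod_reg_fst|apply: prod_reg_snd].
  by apply/R1; exists g.
by apply/R2; exists g.
Qed.

Definition ind_prod : ind_structure k (V * W) :=
  IndStructure prod_exhaustive prod_affine prod_closed.

End IndProduct.

Record ind_group (k : fieldType) := IndGroup {
  ind_group_sort :> groupType;
  ind_group_structure : ind_structure k ind_group_sort;
  ind_group_mul : is_ind_morphism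
    (ind_prod ind_group_structure ind_group_structure) ind_group_structure
    (fun gh => gh.1 * gh.2)%g;
  ind_group_inv : is_ind_morphism ind_group_structure ind_group_structure
    (fun g => g^-1)%g }.

Definition ind_group_iso (k : fieldType) (G H : ind_group k) : Prop :=
  exists (phi : G -> H) (psi : H -> G),
    [/\ {morph phi : x y / (x * y)%g >-> (x * y)%g},
        cancel phi psi, cancel psi phi,
        is_ind_morphism (ind_group_structure G) (ind_group_structure H) phi
      & is_ind_morphism (ind_group_structure H) (ind_group_structure G) psi].

Section DegreeBounds.
Variable k : fieldType.

Lemma msizeM_bound n (p q : {mpoly k[n]}) a b :
  (msize p <= a.+1)%N -> (msize q <= b.+1)%N -> (msize (p * q) <= (a + b).+1)%N.
Proof.
have [->|pN0] := eqVneq p 0; first by rewrite mul0r msize0.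
have [->|qN0] := eqVneq q 0; first by rewrite mulr0 msize0.
rewrite msizeM // => hp hq; apply: (@leq_trans (a.+1 + b.+1).-1).
  by rewrite -!subn1 leq_sub2r // leq_add.
by rewrite addSn /= addnS.
Qed.

Lemma msizeD_bound n (p q : {mpoly k[n]}) a :
  (msize p <= a)%N -> (msize q <= a)%N -> (msize (p + q) <= a)%N.
Proof.
by move=> hp hq; apply: leq_trans (mmeasureD_le _ _ _) _; rewrite geq_max hp.
Qed.

Lemma msize_sum_bound n (I : eqType) (r : seq I) (F : I -> {mpoly k[n]}) a :
  (forall i, i \in r -> (msize (F i) <= a)%N) ->
  (msize (\sum_(i <- r) F i) <= a)%N.
Proof.
move=> hF; rewrite big_seq; elim/big_ind: _ => [|p q|i /hF //].
  by rewrite msize0.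
exact: msizeD_bound.
Qed.

Lemma msize_comp_bound m n (p : {mpoly k[m]}) (q : m.-tuple {mpoly k[n]}) a b :
  (msize p <= a.+1)%N -> (forall i, (msize (tnth q i) <= b.+1)%N) ->
  (msize (p \mPo q) <= (a * b).+1)%N.
Proof.
move=> hp hq; rewrite comp_mpolyE; apply: msize_sum_bound => mu /msize_mdeg_lt hmu.
apply: leq_trans (msizeZ_le _ _) _.
apply: (@leq_trans (mdeg mu * b).+1); last first.
  by rewrite ltnS leq_mul2r -ltnS (leq_trans hmu hp) orbT.
rewrite mdegE big_distrl /=.
elim/big_ind2: _ => [|p1 d1 p2 d2|i _]; first by rewrite msize1.
  exact: msizeM_bound.
elim: (mu i) => [|e IHe]; first by rewrite expr0 msize1.
by rewrite exprS mulSn; apply: msizeM_bound.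
Qed.

End DegreeBounds.

Section LinearForms.
Variables (k : fieldType) (U : lmodType k).

(* The symmetric algebra on the dual space, seen as functions on [U]. *)
Definition polynomial_functions : set (U -> k) :=
  generated_algebra [set l | scalar l].

End LinearForms.

Section FunctionSpaces.
Variables (k : fieldType) (T : Type) (n : nat).
Local Notation U := (T -> 'rV[k]_n).

Lemma pw_0 x j : (0 : U) x 0 j = 0.
Proof. by rewrite -[LHS]/((0 : 'rV[k]_n) 0 j) mxE. Qed.

Lemma pw_D (u v : U) x j : (u + v) x 0 j = u x 0 j + v x 0 j.
Proof. by rewrite -[LHS]/((u x + v x) 0 j) mxE. Qed.

Lemma pw_B (u v : U) x j : (u - v) x 0 j = u x 0 j - v x 0 j.
Proof. by rewrite -[LHS]/((u x - v x) 0 j) !mxE. Qed.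

Lemma pw_Z a (u : U) x j : (a *: u) x 0 j = a * u x 0 j.
Proof. by rewrite -[LHS]/((a *: u x) 0 j) mxE. Qed.

Lemma pw_sum (I : Type) (r : seq I) (F : I -> U) x j :
  (\sum_(i <- r) F i) x 0 j = \sum_(i <- r) F i x 0 j.
Proof. by elim: r => [|i r IH]; rewrite ?big_nil ?pw_0 // !big_cons pw_D IH. Qed.

Definition eval_comb (s : seq (k * T * 'I_n)) : U -> k :=
  fun u => \sum_(z <- s) z.1.1 * u z.1.2 0 z.2.

Lemma eval_comb_scalar s : scalar (eval_comb s).
Proof.
move=> a u v; rewrite /eval_comb mulr_sumr -big_split /=.
by apply: eq_bigr => z _; rewrite pw_D pw_Z mulrDr mulrCA.
Qed.

(* A frame of a subspace: vectors [z.1] and forms [z.2] such that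
   [u = \sum_z z.2 u *: z.1] for all [u] in the subspace. *)
Definition frame_proj (fr : seq (U * seq (k * T * 'I_n))) (u : U) : U :=
  \sum_(z <- fr) eval_comb z.2 u *: z.1.

Lemma frame_proj_linear fr a u v :
  frame_proj fr (a *: u + v) = a *: frame_proj fr u + frame_proj fr v.
Proof.
rewrite /frame_proj scaler_sumr -big_split /=; apply: eq_bigr => z _.
by rewrite eval_comb_scalar scalerDl scalerA.
Qed.

Definition is_subspace (W : set U) : Prop :=
  W 0 /\ forall a u v, W u -> W v -> W (a *: u + v).

Lemma subspace_sum (W : set U) (I : eqType) (r : seq I) (F : I -> U) (c : I -> k) :
  is_subspace W -> (forall i, i \in r -> W (F i)) -> W (\sum_(i <- r) c i *: F i).
Proof.
move=> [W0 WD] hF; rewrite big_seq; elim/big_rec: _ => // i u /hF Fi Wu.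
exact: WD.
Qed.

Lemma frame_exists (W : set U) (s : seq U) :
  is_subspace W -> (forall w, w \in s -> W w) ->
  exists fr, (forall i, W (nth (0, [::]) fr i).1) /\
             (forall w, w \in s -> frame_proj fr w = w).
Proof.
move=> [W0 WD]; elim: s => [|w s IHs] sW.
  by exists [::]; split => // i; rewrite nth_nil.
have {IHs} [|fr [frW frs]] := IHs; first by move=> v vs; apply: sW; rewrite inE vs orbT.
pose w' := w - frame_proj fr w.
have WP u : W (frame_proj fr u).
  rewrite /frame_proj (big_nth (0, [::])).
  elim/big_rec: _ => // i v _ Wv; exact: WD.
have [w'0|[x [j w'xj]]] : w' = 0 \/ exists x j, w' x 0 j != 0.
  have [h|h] := pselect (exists x j, w' x 0 j != 0); [by right|left].
  apply/funext => x; apply/rowP => j; rewrite [RHS]mxE.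
  by apply/eqP/negPn/negP => ?; apply: h; exists x, j.
  exists fr; split=> // v; rewrite inE => /orP[/eqP ->|/frs //].
  by apply/eqP; rewrite eq_sym -subr_eq0; apply/eqP.
(* the form  u |-> (u - frame_proj fr u) x 0 j / w' x 0 j *)
pose c := (w' x 0 j)^-1.
pose l : seq (k * T * 'I_n) := (c, x, j) ::
  flatten [seq [seq (- (c * z.1 x 0 j) * y.1.1, y.1.2, y.2) | y <- z.2] | z : U * _ <- fr].
have lE u : eval_comb l u = c * (u - frame_proj fr u) x 0 j.
  rewrite /eval_comb big_cons /= big_flatten /= big_map.
  rewrite /frame_proj pw_B mulrBr; congr (_ + _).
  rewrite -mulrN; elim: (fr) => [|z fr' IH].
    by rewrite !big_nil pw_0 oppr0 mulr0.
  rewrite !big_cons IH pw_D pw_Z opprD mulrDr; congr (_ + _).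
  rewrite big_map /eval_comb mulr_suml mulrN mulr_sumr -sumrN.
  apply: eq_bigr => y _ /=; rewrite !mulNr -!mulrA; congr (- (_ * _)).
  by rewrite mulrC -mulrA.
exists ((w', l) :: fr); split.
  case=> [|i]; last exact: frW.
  by rewrite /= /w' addrC -scaleN1r; apply: WD; [apply: WP|apply: sW; rewrite inE eqxx].
have E u : frame_proj ((w', l) :: fr) u = eval_comb l u *: w' + frame_proj fr u.
  by rewrite /frame_proj big_cons.
move=> v; rewrite inE E lE => /orP[/eqP ->|/frs ->].
  by rewrite -/w' mulVf // scale1r subrK.
by rewrite subrr pw_0 mulr0 scale0r add0r.
Qed.

Lemma subspace_fixed fr : is_subspace [set u | frame_proj fr u = u].
Proof.
split=> [|a u v /= hu hv]; last by rewrite frame_proj_linear hu hv.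
have := frame_proj_linear fr (-1) 0 0.
by rewrite scaler0 addr0 scaleN1r addNr.
Qed.

Lemma eval_scalar x j : scalar (fun u : U => u x 0 j).
Proof. by move=> a u v; rewrite pw_D pw_Z. Qed.

Lemma scalar_sum (l : U -> k) (I : Type) (r : seq I) (c : I -> k) (F : I -> U) :
  scalar l -> l (\sum_(i <- r) c i *: F i) = \sum_(i <- r) c i * l (F i).
Proof.
move=> ll; elim: r => [|i r IH]; last by rewrite !big_cons ll IH.
rewrite !big_nil; have := ll (-1) 0 0.
by rewrite scaler0 addr0 mulN1r addNr.
Qed.

End FunctionSpaces.

Section AutomorphismGroup.
Variables (k : fieldType) (X : affine_variety k).
Local Notation m := (ambient_dim X).

Record automorphism := Automorphism {
  aut_fun : X -> X;
  aut_inv : X -> X;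
  aut_fun_morphism : is_morphism aut_fun;
  aut_inv_morphism : is_morphism aut_inv;
  aut_funK : cancel aut_fun aut_inv;
  aut_invK : cancel aut_inv aut_fun }.

Lemma automorphism_eq (g h : automorphism) : aut_fun g =1 aut_fun h -> g = h.
Proof.
case: g h => [f f' mf mf' fK f'K] [g g' mg mg' gK g'K] /= /funext E.
subst g; have E' : f' = g' by apply/funext => x; rewrite -{1}(g'K x) fK.
by subst g'; congr Automorphism; exact: Prop_irrelevance.
Qed.

HB.instance Definition _ := gen_eqMixin automorphism.
HB.instance Definition _ := gen_choiceMixin automorphism.

Definition aut_one : automorphism := Automorphism
  (is_morphism_id X) (is_morphism_id X) (fun=> erefl) (fun=> erefl).

Definition aut_inverse (g : automorphism) : automorphism := Automorphism
  (aut_inv_morphism g) (aut_fun_morphism g) (@aut_invK g) (@aut_funK g).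

Definition aut_mul (g h : automorphism) : automorphism := Automorphism
  (is_morphism_comp (aut_fun_morphism g) (aut_fun_morphism h))
  (is_morphism_comp (aut_inv_morphism h) (aut_inv_morphism g))
  (can_comp (@aut_funK g) (@aut_funK h))
  (can_comp (@aut_invK h) (@aut_invK g)).

Fact aut_mulA : associative aut_mul.
Proof. by move=> f g h; exact: automorphism_eq. Qed.
Fact aut_mul1g : left_id aut_one aut_mul.
Proof. by move=> g; exact: automorphism_eq. Qed.
Fact aut_mulg1 : right_id aut_one aut_mul.
Proof. by move=> g; exact: automorphism_eq. Qed.
Fact aut_mulVg : left_inverse aut_one aut_inverse aut_mul.
Proof. by move=> g; apply: automorphism_eq => x /=; rewrite aut_funK. Qed.
Fact aut_mulgV : right_inverse aut_one aut_inverse aut_mul.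
Proof. by move=> g; apply: automorphism_eq => x /=; rewrite aut_invK. Qed.

HB.instance Definition _ := isGroup.Build automorphism
  aut_mulA aut_mul1g aut_mulg1 aut_mulVg aut_mulgV.

(* The finite-dimensional subspaces [O(X)_d^n] of [O(X)^n], where [O(X)_d] is
   the image of the polynomials of degree at most [d] ([msize] is one more than
   the total degree). *)
Definition regular_maps_le (n d : nat) : set (X -> 'rV[k]_n) :=
  [set u | forall j, exists2 p : {mpoly k[m]}, (msize p <= d.+1)%N
                     & forall x : X, u x 0 j = p.@[val x 0]].

(* The inclusion of [Aut(X)] in [End(X) x End(X)], hence in [O(X)^m x O(X)^m],
   identified here with [O(X)^(m + m)]. *)
Definition aut_pair (g : automorphism) : X -> 'rV[k]_(m + m) :=
  fun x => row_mx (val (aut_fun g x)) (val (aut_inv g x)).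

Definition aut_fil (d : nat) : set automorphism :=
  [set g | @regular_maps_le (m + m) d (aut_pair g)].

(* [Aut(X)_d] is closed in the vector space [O(X)_d^m x O(X)_d^m], so its regular
   functions are the restrictions of the polynomial functions on that space.
   Linear forms on a subspace being restrictions of linear forms on the whole
   space, these may be taken on all functions [X -> k^(m + m)]. *)
Definition aut_reg (d : nat) : set (automorphism -> k) :=
  [set f | exists2 F, polynomial_functions F
           & forall g, aut_fil d g -> f g = F (aut_pair g)].

Lemma regular_maps_subspace n d : is_subspace (@regular_maps_le n d).
Proof.
split=> [j|a u v hu hv j].
  by exists 0; [rewrite msize0|move=> x; rewrite pw_0 meval0].
have [p sp hp] := hu j; have [q sq hq] := hv j.
exists (a *: p + q); last by move=> x; rewrite pw_D pw_Z mevalD mevalZ hp hq.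
by apply: msizeD_bound sq; apply: leq_trans (msizeZ_le _ _) sp.
Qed.

Lemma regular_maps_frame n d : exists fr,
  (forall i, @regular_maps_le n d (nth (0, [::]) fr i).1) /\
  (forall u, @regular_maps_le n d u -> frame_proj fr u = u).
Proof.
pose G (z : 'X_{1..m < d.+1} * 'I_n) : X -> 'rV[k]_n :=
  fun x => 'X_[z.1].@[val x 0] *: delta_mx 0 z.2.
have GE z x j : G z x 0 j = 'X_[z.1].@[val x 0] * (j == z.2)%:R.
  by rewrite !mxE eqxx.
have [w|fr [frW frE]] :=
  @frame_exists k X n (@regular_maps_le n d) [seq G z | z <- enum predT]
    (regular_maps_subspace n d).
  case/mapP => z _ -> j; exists ((j == z.2)%:R *: 'X_[z.1]).
    by apply: leq_trans (msizeZ_le _ _) _; rewrite msizeX bmdeg.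
  by move=> x; rewrite mevalZ GE mulrC.
exists fr; split => // u hu.
have [p hp] := @choice 'I_n {mpoly k[m]} (fun j p =>
  (msize p <= d.+1)%N /\ forall x : X, u x 0 j = p.@[val x 0])
  (fun j => let: ex_intro2 p sp hp := hu j in ex_intro _ p (conj sp hp)).
have -> : u = \sum_(z : 'X_{1..m < d.+1} * 'I_n) (p z.2)@_z.1 *: G z.
  apply/funext => x; apply/rowP => j; rewrite pw_sum (hp j).2.
  rewrite [in LHS](mpolywE (hp j).1) raddf_sum /=.
  rewrite -(pair_bigA _ (fun (mu : 'X_{1..m < d.+1}) (i : 'I_n) => ((p i)@_mu *: G (mu, i)) x 0 j)) /=.
  apply: eq_bigr => mu _; rewrite (bigD1 j) //= big1 ?addr0 => [|i ij].
    by rewrite mevalZ pw_Z GE eqxx mulr1.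
  by rewrite pw_Z GE eq_sym (negbTE ij) !mulr0.
apply: (subspace_sum _ (subspace_fixed fr)) => z _.
by apply: frE; apply: map_f; rewrite mem_enum.
Qed.

Lemma regular_maps_expand n d : exists (N : nat) (b : 'I_N -> X -> 'rV[k]_n)
    (s : 'I_N -> seq (k * X * 'I_n)),
  (forall t, @regular_maps_le n d (b t)) /\
  (forall u, @regular_maps_le n d u -> u = \sum_t eval_comb (s t) u *: b t).
Proof.
have [fr [frW frE]] := regular_maps_frame n d.
exists (size fr), (fun t => (nth (0, [::]) fr t).1),
  (fun t => (nth (0, [::]) fr t).2); split=> // u /frE.
by rewrite /frame_proj (big_nth (0, [::])) big_mkord.
Qed.

Lemma regular_maps_le_leq n d e : (d <= e)%N ->
  @regular_maps_le n d `<=` @regular_maps_le n e.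
Proof.
move=> de u hu j; have [p sp hp] := hu j; exists p => //.
exact: leq_trans sp _.
Qed.

Lemma aut_pair_lshift g x i : aut_pair g x 0 (lshift m i) = val (aut_fun g x) 0 i.
Proof. exact: row_mxEl. Qed.

Lemma aut_pair_rshift g x i : aut_pair g x 0 (rshift m i) = val (aut_inv g x) 0 i.
Proof. exact: row_mxEr. Qed.

Lemma aut_pair_inj g h : aut_pair g = aut_pair h -> g = h.
Proof.
move=> E; apply: automorphism_eq => x; apply: val_inj.
by apply/rowP => i; rewrite -!aut_pair_lshift E.
Qed.

Lemma aut_exhaustive g : exists d, aut_fil d g.
Proof.
have [P hP] := aut_fun_morphism g; have [Q hQ] := aut_inv_morphism g.
exists (maxn (\max_j msize (P j)) (\max_j msize (Q j))) => j.
case: (split_ordP j) => i ->.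
  exists (P i); last by move=> x; rewrite aut_pair_lshift hP.
  by apply: leqW; rewrite leq_max (leq_bigmax i).
exists (Q i); last by move=> x; rewrite aut_pair_rshift hQ.
by apply: leqW; rewrite leq_max (leq_bigmax i) orbT.
Qed.

Lemma aut_reg_subalg d : is_subalgebra (aut_reg d).
Proof.
have [Gc GD GM] :=
  generated_algebra_subalg [set l : (X -> 'rV[k]_(m + m)) -> k | scalar l].
split.
- by move=> c; exists (cst c) => //; apply: Gc.
- move=> f g [F hF fF] [G hG gG]; exists (F \+ G); first exact: GD.
  by move=> v hv; rewrite /= fF // gG.
- move=> f g [F hF fF] [G hG gG]; exists (F \* G); first exact: GM.
  by move=> v hv; rewrite /= fF // gG.
Qed.

Lemma aut_reg_scalar d l : scalar l -> aut_reg d (l \o aut_pair).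
Proof. by move=> ll; exists l => //; apply: generated_algebra_gen. Qed.

Lemma subalgebra_scale (V : Type) (R : set (V -> k)) a f :
  is_subalgebra R -> R f -> R (fun v => f v * a).
Proof. by move=> [Rc _ RM] Rf; apply: (RM f (cst a)). Qed.

Lemma subalgebra_sub (V : Type) (R : set (V -> k)) f g :
  is_subalgebra R -> R f -> R g -> R (fun v => f v - g v).
Proof.
move=> RA Rf Rg; have [_ RD _] := RA.
rewrite (_ : (fun _ => _) = f \+ (fun v => g v * -1)).
  by apply: RD => //; apply: subalgebra_scale.
by apply/funext => v /=; rewrite mulrN1.
Qed.

Lemma aut_affine d : is_affine_structure (aut_fil d) (aut_reg d).
Proof.
have [N [b [s [bW bE]]]] := regular_maps_expand (m + m) d.
pose e g : 'rV[k]_N := \row_t eval_comb (s t) (aut_pair g).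
have eE g : aut_fil d g -> aut_pair g = \sum_t e g 0 t *: b t.
  by move=> /bE {1}->; apply: eq_bigr => t _; rewrite mxE.
exists N, e; split.
- by move=> g h /eE Eg /eE Eh E; apply: aut_pair_inj; rewrite Eg Eh E.
- have [B hB] := @choice 'I_N ('I_(m + m) -> {mpoly k[m]})
    (fun t B => forall j (x : X), b t x 0 j = (B j).@[val x 0])
    (fun t => let: existT B hB := @choice 'I_(m + m) {mpoly k[m]}
        (fun j p => forall x : X, b t x 0 j = p.@[val x 0])
        (fun j => let: ex_intro2 p _ hp := bW t j in ex_intro _ p hp)
      in ex_intro _ B hB).
  pose u (c : 'rV[k]_N) : X -> 'rV[k]_(m + m) := \sum_t c 0 t *: b t.
  pose Bc (c : 'rV[k]_N) j (y : 'I_m -> k) := \sum_t c 0 t * (B t j).@[y].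
  have uE c x j : u c x 0 j = Bc c j (val x 0).
    by rewrite pw_sum; apply: eq_bigr => t _; rewrite pw_Z hB.
  pose sh (left : bool) (i : 'I_m) : 'I_(m + m) :=
    if left then lshift m i else rshift m i.
  have CA := @chart_functions_subalg k 'rV[k]_N N setT id.
  have Ccoord t : chart_functions setT id (fun c : 'rV[k]_N => c 0 t).
    exact: (@chart_functions_coord k 'rV[k]_N N setT id).
  have CB j (y : 'I_m -> 'rV[k]_N -> k) :
      (forall i, chart_functions setT id (y i)) ->
      chart_functions setT id (fun c => Bc c j (y^~ c)).
    move=> hy; apply: subalgebra_sum => // t; have [_ _ CM] := CA.
    apply: (CM (fun c => c 0 t) (fun c => (B t j).@[y^~ c])) => //.
    exact: subalgebra_meval.
  have Ccst a : chart_functions setT id (fun _ : 'rV[k]_N => a).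
    by have [Cc _ _] := CA; apply: Cc.
  pose J : set ('rV[k]_N -> k) := [set f |
    [\/ exists t, f = fun c => eval_comb (s t) (u c) - c 0 t,
        exists (left : bool) (q : {mpoly k[m]}) (x : X),
          (forall z, locus X z -> q.@[z 0] = 0) /\
          f = fun c => q.@[fun i => Bc c (sh left i) (val x 0)]
      | exists (left : bool) (x : X) i,
          f = fun c => Bc c (sh left i)
                (fun i' => Bc c (sh (~~ left) i') (val x 0)) - val x 0 i]].
  apply: (@zariski_closed_functions k _ _ J) => [f|c].
    case=> [[t ->]|[left [q [x [_ ->]]]]|[left [x [i ->]]]].
    + apply: subalgebra_sub => //.
      have lE c : eval_comb (s t) (u c) = \sum_t' c 0 t' * eval_comb (s t) (b t').
        by apply: scalar_sum; apply: eval_comb_scalar.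
      apply: (eq_chart_functions (fun c _ => esym (lE c))).
      by apply: subalgebra_sum => // t'; apply: subalgebra_scale.
    + apply: subalgebra_meval => // i.
      exact: (CB _ (fun i _ => val x 0 i)).
    + apply: subalgebra_sub => //.
      apply: (CB _ (fun i' c => Bc c (sh (~~ left) i') (val x 0))) => i'.
      exact: (CB _ (fun i _ => val x 0 i)).
  split.
    case=> g hg <-.
    have uc : u (e g) = aut_pair g by rewrite (eE g hg).
    have BcE left i (x : X) : Bc (e g) (sh left i) (val x 0) =
        val ((if left then aut_fun g else aut_inv g) x) 0 i.
      by rewrite -uE uc; case: left; rewrite ?aut_pair_lshift ?aut_pair_rshift.
    move=> f [[t ->]|[left [q [x [hq ->]]]]|[left [x [i ->]]]].
    + by rewrite uc mxE subrr.
    + under meval_eq do rewrite BcE.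
      by apply: hq; apply: set_valP.
    + rewrite [X in X - _](_ : _ = val x 0 i) ?subrr //.
      have -> : (fun i' => Bc (e g) (sh (~~ left) i') (val x 0)) =
          val ((if ~~ left then aut_fun g else aut_inv g) x) 0.
        by apply/funext => i'; rewrite BcE.
      by rewrite BcE; case: left => /=; rewrite ?aut_invK ?aut_funK.
  move=> hJ.
  pose y left (x : X) : 'rV[k]_m := \row_i Bc c (sh left i) (val x 0).
  have yX left x : locus X (y left x).
    apply/(zariski_closed_poly _ (locus_closed X)) => q hq.
    rewrite -[RHS](hJ (fun c => q.@[fun i => Bc c (sh left i) (val x 0)])).
      by apply: meval_eq => i; rewrite mxE.
    by apply: Or32; exists left, q, x.
  pose F left (x : X) : X := SigSub (mem_set (yX left x)).
  have FE left x i : val (F left x) 0 i = Bc c (sh left i) (val x 0).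
    by rewrite mxE.
  have Fmor left : is_morphism (F left).
    exists (fun i => \sum_t c 0 t *: B t (sh left i)) => x i.
    rewrite FE raddf_sum /=; apply: eq_bigr => t _; by rewrite mevalZ.
  have FK left : cancel (F (~~ left)) (F left).
    move=> x; apply: val_inj; apply/rowP => i; rewrite FE.
    apply/eqP; rewrite -subr_eq0; apply/eqP.
    rewrite -[RHS](hJ (fun c => Bc c (sh left i)
               (fun i' => Bc c (sh (~~ left) i') (val x 0)) - val x 0 i)).
      by congr (Bc c _ _ - _); apply/funext => i'; rewrite FE.
    by apply: Or33; exists left, x, i.
  pose g := Automorphism (Fmor true) (Fmor false) (FK false) (FK true).
  have gu : aut_pair g = u c.
    apply/funext => x; apply/rowP => j; rewrite uE.
    case: (split_ordP j) => i ->.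
      by rewrite aut_pair_lshift FE.
    by rewrite aut_pair_rshift FE.
  exists g.
    rewrite /aut_fil /= gu; apply: (subspace_sum _ (regular_maps_subspace _ d)).
    by move=> t _; apply: bW.
  apply/rowP => t; rewrite mxE gu; apply/eqP; rewrite -subr_eq0; apply/eqP.
  by apply: (hJ (fun c => eval_comb (s t) (u c) - c 0 t)); apply: Or31; exists t.
- move=> f; split.
  + case=> F hF fF.
    apply: (@eq_chart_functions _ _ _ _ e (F \o aut_pair)).
      by move=> g hg; rewrite fF.
    suff sub : @polynomial_functions k (X -> 'rV[k]_(m + m)) `<=`
        [set F : (X -> 'rV[k]_(m + m)) -> k |
          chart_functions (aut_fil d) e (F \o aut_pair)] by exact: sub.
    apply: generated_algebra_ind.
      have [Cc CD CM] := chart_functions_subalg (aut_fil d) e.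
      by split=> [a|G H|G H]; [apply: Cc|apply: CD|apply: CM].
    move=> l /= ll.
    apply: (@eq_chart_functions _ _ _ _ _ (fun g => \sum_t e g 0 t * l (b t))).
      by move=> g hg; rewrite /= [in RHS]eE // scalar_sum.
    apply: subalgebra_sum => [|t]; first exact: chart_functions_subalg.
    apply: (@subalgebra_scale _ _ _ (fun g => e g 0 t)).
      exact: chart_functions_subalg.
    exact: chart_functions_coord.
  + case=> p hp; exists (fun u => p.@[fun t => eval_comb (s t) u]).
      apply: (@subalgebra_meval _ _ _ _ (fun t => eval_comb (s t))).
        exact: generated_algebra_subalg.
      by move=> t; apply: generated_algebra_gen; apply: eval_comb_scalar.
    by move=> g hg; rewrite hp //; apply: meval_eq => t; rewrite mxE.
Qed.

Lemma aut_closed d :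
  is_closed_subvariety (aut_fil d) (aut_reg d) (aut_fil d.+1) (aut_reg d.+1).
Proof.
have sub : aut_fil d `<=` aut_fil d.+1.
  by move=> g; apply: regular_maps_le_leq (leqnSn d) _.
split; last first.
  move=> f; split=> [[F hF fF]|[f' [F hF fF] ff']].
    by exists (F \o aut_pair) => //; exists F.
  by exists F => // g hg; rewrite ff' // fF //; apply: sub.
have [N [b [s [bW bE]]]] := regular_maps_expand (m + m) d.
exists [set f | exists2 l, scalar l /\ (forall u, @regular_maps_le (m + m) d u -> l u = 0)
                & f = l \o aut_pair].
  by move=> _ [l [ll _] ->]; apply: aut_reg_scalar.
apply/seteqP; split=> [g hg|g [_ /= hg]].
  by split; [apply: sub|move=> _ [l [_ l0] ->]; apply: l0].
pose P (u : X -> 'rV[k]_(m + m)) : X -> 'rV[k]_(m + m) :=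
  \sum_t eval_comb (s t) u *: b t.
have PD a u v : P (a *: u + v) = a *: P u + P v.
  rewrite /P scaler_sumr -big_split /=; apply: eq_bigr => t _.
  by rewrite eval_comb_scalar scalerDl scalerA.
have PE : aut_pair g = P (aut_pair g).
  apply/funext => x; apply/rowP => j; apply/eqP; rewrite -subr_eq0; apply/eqP.
  pose l (u : X -> 'rV[k]_(m + m)) := u x 0 j - P u x 0 j.
  apply: (hg (l \o aut_pair)); exists l => //; split; last first.
    by move=> u /bE ue; have Pu : P u = u by []; rewrite /l Pu subrr.
  by move=> a u v; rewrite /l PD !pw_D !pw_Z mulrBr opprD addrACA.
rewrite /aut_fil /= PE; apply: (subspace_sum _ (regular_maps_subspace _ d)).
by move=> t _; apply: bW.
Qed.

Definition aut_structure : ind_structure k automorphism :=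
  IndStructure aut_exhaustive aut_affine aut_closed.

Fact aut_inv_ind_morphism :
  is_ind_morphism aut_structure aut_structure (fun g => g^-1)%g.
Proof.
pose sw (u : X -> 'rV[k]_(m + m)) : X -> 'rV[k]_(m + m) :=
  fun x => row_mx (rsubmx (u x)) (lsubmx (u x)).
have swE (g : automorphism) : aut_pair (g^-1)%g = sw (aut_pair g).
  by apply/funext => x; rewrite /sw row_mxKl row_mxKr.
have swL a u v : sw (a *: u + v) = a *: sw u + sw v.
  apply/funext => x; apply/rowP => j; rewrite pw_D pw_Z.
  by case: (split_ordP j) => i ->;
     rewrite ?(row_mxEl, row_mxEr) !mxE ?(pw_D, pw_Z).
move=> d; exists d; split=> [g hg j|f [F hF fF]].
  rewrite swE; case: (split_ordP j) => i ->.
    have [p sp hp] := hg (rshift m i); exists p => // x.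
    by rewrite row_mxEl mxE hp.
  have [p sp hp] := hg (lshift m i); exists p => // x.
  by rewrite row_mxEr mxE hp.
have Psw : @polynomial_functions k (X -> 'rV[k]_(m + m)) `<=`
    [set G : (X -> 'rV[k]_(m + m)) -> k | polynomial_functions (G \o sw)].
  apply: generated_algebra_ind.
    have [Gc GD GM] :=
      generated_algebra_subalg [set l : (X -> 'rV[k]_(m + m)) -> k | scalar l].
    by split=> [a|G H|G H]; [apply: Gc|apply: GD|apply: GM].
  move=> l ll; apply: generated_algebra_gen => a u v.
  by rewrite /= swL ll.
exists (F \o sw); first exact: Psw.
move=> g hg; rewrite /= fF ?swE //= /aut_fil /=.
move=> j; rewrite swE; case: (split_ordP j) => i ->.
  have [p sp hp] := hg (rshift m i); exists p => // x.
  by rewrite row_mxEl mxE hp.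
have [p sp hp] := hg (lshift m i); exists p => // x.
by rewrite row_mxEr mxE hp.
Qed.

Lemma regular_maps_comp n d e (u : X -> 'rV[k]_n) (phi : X -> X) :
  regular_maps_le d u -> regular_maps_le e (fun x => val (phi x)) ->
  regular_maps_le (d * e) (u \o phi).
Proof.
move=> hu hphi j; have [p sp hp] := hu j.
have [q hq] := @choice 'I_m {mpoly k[m]} (fun i q =>
  (msize q <= e.+1)%N /\ forall x : X, val (phi x) 0 i = q.@[val x 0])
  (fun i => let: ex_intro2 q sq hq := hphi i in ex_intro _ q (conj sq hq)).
exists (p \mPo [tuple q i | i < m]).
  by apply: msize_comp_bound => // i; rewrite tnth_mktuple (hq i).1.
move=> x; rewrite /= hp comp_mpoly_meval; apply: meval_eq => i.
by rewrite tnth_mktuple (hq i).2.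
Qed.

Lemma aut_fil_fun d g : aut_fil d g -> regular_maps_le d (fun x => val (aut_fun g x)).
Proof.
move=> hg i; have [p sp hp] := hg (lshift m i).
by exists p => // x; rewrite -hp aut_pair_lshift.
Qed.

Lemma aut_fil_inv d g : aut_fil d g -> regular_maps_le d (fun x => val (aut_inv g x)).
Proof.
move=> hg i; have [p sp hp] := hg (rshift m i).
by exists p => // x; rewrite -hp aut_pair_rshift.
Qed.

Lemma aut_pair_mul_lshift (g h : automorphism) x i :
  aut_pair (g * h)%g x 0 (lshift m i) = aut_pair g (aut_fun h x) 0 (lshift m i).
Proof. by rewrite !aut_pair_lshift. Qed.

Lemma aut_pair_mul_rshift (g h : automorphism) x i :
  aut_pair (g * h)%g x 0 (rshift m i) = aut_pair h (aut_inv g x) 0 (rshift m i).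
Proof. by rewrite !aut_pair_rshift. Qed.

Lemma aut_fil_mul d (g h : automorphism) :
  aut_fil d g -> aut_fil d h -> aut_fil (d * d) (g * h)%g.
Proof.
move=> hg hh j; case: (split_ordP j) => i ->.
  have [p sp hp] := regular_maps_comp hg (aut_fil_fun hh) (lshift m i).
  by exists p => // x; rewrite aut_pair_mul_lshift -hp.
have [p sp hp] := regular_maps_comp hh (aut_fil_inv hg) (rshift m i).
by exists p => // x; rewrite aut_pair_mul_rshift -hp.
Qed.

Fact aut_mul_ind_morphism :
  is_ind_morphism (ind_prod aut_structure aut_structure) aut_structure
    (fun gh => gh.1 * gh.2)%g.
Proof.
move=> d; exists (d * d)%N; split; first by move=> [g h] [/= ? ?]; apply: aut_fil_mul.
have RA := prod_reg_subalg aut_structure aut_structure d.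
have [_ _ RM] := RA.
have fstR l : scalar l -> prod_reg aut_structure aut_structure d
    (fun gh => l (aut_pair gh.1)).
  by move=> ll; apply: (@prod_reg_fst _ _ _ aut_structure _ d (l \o aut_pair));
     apply: aut_reg_scalar.
have sndR l : scalar l -> prod_reg aut_structure aut_structure d
    (fun gh => l (aut_pair gh.2)).
  by move=> ll; apply: (@prod_reg_snd _ _ _ _ aut_structure d (l \o aut_pair));
     apply: aut_reg_scalar.
have evalR x j : prod_reg aut_structure aut_structure d
    (fun gh : automorphism * automorphism => aut_pair (gh.1 * gh.2)%g x 0 j).
  have [N [b [s [bW bE]]]] := regular_maps_expand (m + m) d.
  have [B hB] := @choice 'I_N {mpoly k[m]}
    (fun t p => forall x : X, b t x 0 j = p.@[val x 0])
    (fun t => let: ex_intro2 p _ hp := bW t j in ex_intro _ p hp).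
  have pairE g y : aut_fil d g -> aut_pair g y 0 j =
      \sum_t eval_comb (s t) (aut_pair g) * (B t).@[val y 0].
    move=> /bE {1}->; rewrite pw_sum; apply: eq_bigr => t _.
    by rewrite pw_Z hB.
  case: (split_ordP j) => i ji.
    apply: (@eq_prod_reg _ _ _ _ _ _ (fun gh => \sum_t
        eval_comb (s t) (aut_pair gh.1) *
        (B t).@[fun i => aut_pair gh.2 x 0 (lshift m i)])).
      move=> [g h] [/= hg hh]; rewrite ji aut_pair_mul_lshift -ji pairE //.
      apply: eq_bigr => t _; congr (_ * _); apply: meval_eq => i'.
      by rewrite aut_pair_lshift.
    apply: subalgebra_sum => // t.
    apply: (RM (fun gh => eval_comb (s t) (aut_pair gh.1))
      (fun gh => (B t).@[fun i => aut_pair gh.2 x 0 (lshift m i)])).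
      by apply: fstR; apply: eval_comb_scalar.
    apply: (@subalgebra_meval _ _ _ _
      (fun i gh => aut_pair gh.2 x 0 (lshift m i))) => // i'.
    by apply: (sndR (fun u => u x 0 (lshift m i'))); apply: eval_scalar.
  apply: (@eq_prod_reg _ _ _ _ _ _ (fun gh => \sum_t
      eval_comb (s t) (aut_pair gh.2) *
      (B t).@[fun i => aut_pair gh.1 x 0 (rshift m i)])).
    move=> [g h] [/= hg hh]; rewrite ji aut_pair_mul_rshift -ji pairE //.
    apply: eq_bigr => t _; congr (_ * _); apply: meval_eq => i'.
    by rewrite aut_pair_rshift.
  apply: subalgebra_sum => // t.
  apply: (RM (fun gh => eval_comb (s t) (aut_pair gh.2))
    (fun gh => (B t).@[fun i => aut_pair gh.1 x 0 (rshift m i)])).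
    by apply: sndR; apply: eval_comb_scalar.
  apply: (@subalgebra_meval _ _ _ _
    (fun i gh => aut_pair gh.1 x 0 (rshift m i))) => // i'.
  by apply: (fstR (fun u => u x 0 (rshift m i'))); apply: eval_scalar.
have [N [b [s [bW bE]]]] := regular_maps_expand (m + m) (d * d).
have Pmul : @polynomial_functions k (X -> 'rV[k]_(m + m)) `<=`
    [set G : (X -> 'rV[k]_(m + m)) -> k | prod_reg aut_structure aut_structure d
      (fun gh : automorphism * automorphism => G (aut_pair (gh.1 * gh.2)%g))].
  apply: generated_algebra_ind.
    have [Rc RD _] := RA.
    split=> [a|G H hG hH|G H hG hH]; first exact: Rc.
      exact: (RD _ _ hG hH).
    exact: (RM _ _ hG hH).
  move=> l /= ll.
  apply: (@eq_prod_reg _ _ _ _ _ _ (fun gh => \sum_t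
      eval_comb (s t) (aut_pair (gh.1 * gh.2)%g) * l (b t))).
    by move=> [g h] [/= hg hh]; rewrite [in RHS](bE _ (aut_fil_mul hg hh)) scalar_sum.
  apply: subalgebra_sum => // t.
  apply: (@subalgebra_scale _ _ _
    (fun gh => eval_comb (s t) (aut_pair (gh.1 * gh.2)%g))) => //.
  apply: subalgebra_sum => // z.
  have [Rc _ _] := RA.
  exact: (RM (cst z.1.1) _ (Rc z.1.1) (evalR z.1.2 z.2)).
move=> f [F hF fF].
apply: (@eq_prod_reg _ _ _ _ _ _ (fun gh => F (aut_pair (gh.1 * gh.2)%g))).
  by move=> [g h] [/= hg hh]; rewrite fF //; apply: aut_fil_mul.
exact: Pmul.
Qed.

Definition aut_ind_group : ind_group k :=
  IndGroup aut_mul_ind_morphism aut_inv_ind_morphism.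

End AutomorphismGroup.

(* Main.v *)
Require Import Defs.
From mathcomp Require Import all_boot all_algebra.
From mathcomp Require Import boolp classical_sets functions.
From mathcomp Require Import mpoly ring.

(* Let [V = k^n] be the translation group of affine n-space. It is its own
   centralizer in [Aut(A^n)], so through the isomorphism it acts algebraically
   and faithfully on [X] and is its own centralizer in [Aut(X)]. For a
   [V]-invariant regular function [f] and [w] in [V], the map
   [x |-> (f x *: w) . x] is an automorphism of [X] commuting with [V], so it is
   the action of some [c] in [V]; letting [w] vary one gets a matrix of which
   [f x] is an eigenvalue whenever [x] is not a fixed point. Hence [f] takes
   finitely many values outside the fixed points. As [V] is unipotent, there is
   a nonzero invariant function vanishing on the fixed points; it takes finitely
   many values, so it is constant because [X] is connected, and there are no
   fixed points. Thus all invariants are constant, so every orbit is dense and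
   has trivial stabilizers. The pullbacks of regular functions to an orbit form
   an algebra of polynomials on [k^n], stable under translations and not
   invariant under any nonzero translation; in characteristic 0 it contains all
   coordinates, and [X] is isomorphic to [A^n]. *)

Set Implicit Arguments.
Unset Strict Implicit.
Unset Printing Implicit Defensive.

Import GRing.Theory.

Local Open Scope classical_set_scope.
Local Open Scope ring_scope.

(** * Zeros of one-variable polynomials at the natural numbers *)

Section PolynomialFunctions.
Variable k : fieldType.

Definition univariate_functions : set (k -> k) :=
  [set f | exists p : {poly k}, forall t, f t = p.[t]].

Lemma univariate_functions_subalg : is_subalgebra univariate_functions.
Proof.
split.
- by move=> c; exists c%:P => t; rewrite hornerC.
- by move=> f g [p hp] [q hq]; exists (p + q) => t; rewrite hornerD /= hp hq.
- by move=> f g [p hp] [q hq]; exists (p * q) => t; rewrite hornerM /= hp hq.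
Qed.

Lemma univariate_scale c : univariate_functions (fun t => t * c).
Proof. by exists ('X * c%:P) => t; rewrite hornerM hornerX hornerC. Qed.

Lemma univariate_const c : univariate_functions (fun=> c).
Proof. by exists c%:P => t; rewrite hornerC. Qed.

(** In characteristic 0 the natural numbers have distinct images in [k], so a nonzero polynomial
    vanishing at all of them would have too many roots. This extends identities from natural to
    arbitrary multiples of a vector. *)
Lemma univariate_eq0 f : [pchar k] =i pred0 -> univariate_functions f ->
  (forall i : nat, f i%:R = 0) -> forall t, f t = 0.
Proof.
move=> /pcharf0P k0 [p hp] f0 t; rewrite hp.
suff -> : p = 0 by rewrite horner0.
apply/eqP/negPn/negP => pN0.
pose rs : seq k := [seq i%:R | i <- iota 0 (size p)].
have : (size rs < size p)%N.
  apply: max_poly_roots => //.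
    by apply/allP => _ /mapP[i _ ->]; rewrite rootE -hp f0.
  rewrite map_inj_uniq ?iota_uniq // => i j E.
  have natr_leq u v : u%:R = v%:R :> k -> (v <= u)%N.
    move=> uv; rewrite leqNgt; apply/negP => ltuv; have := k0 (v - u)%N.
    by rewrite natrB ?(ltnW ltuv) // uv subrr eqxx subn_eq0 leqNgt ltuv.
  by apply/eqP; rewrite eqn_leq !natr_leq.
by rewrite size_map size_iota ltnn.
Qed.

End PolynomialFunctions.

(** * Finite differences along a family of maps indexed by [k^n] *)

Section Differences.
Variables (k : fieldType) (n : nat) (Y : Type) (a : 'rV[k]_n -> Y -> Y).
Implicit Types (h : Y -> k) (v : 'rV[k]_n).

Definition difference v h : Y -> k := fun y => h (a v y) - h y.

(** The analogue of having degree less than [d], in terms of differences only, so that it makes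
    sense for functions on any set with an action. *)
Fixpoint diff_order_lt d h : Prop :=
  if d is d'.+1 then forall v, diff_order_lt d' (difference v h)
  else forall y, h y = 0.

Lemma diff_order_lt0 d h : (forall y, h y = 0) -> diff_order_lt d h.
Proof.
elim: d h => [|d IHd] h h0 //= v.
by apply: IHd => y; rewrite /difference !h0 subrr.
Qed.

Lemma diff_order_ltD d f g :
  diff_order_lt d f -> diff_order_lt d g -> diff_order_lt d (f \+ g).
Proof.
elim: d f g => [|d IHd] f g /= hf hg; first by move=> y; rewrite hf hg addr0.
move=> v; rewrite (_ : difference v _ = difference v f \+ difference v g).
  exact: IHd.
by apply/funext => y; rewrite /difference /= opprD addrACA.
Qed.

Lemma diff_order_ltS d h : diff_order_lt d h -> diff_order_lt d.+1 h.
Proof.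
elim: d h => [|d IHd] h /= hh v; last exact: IHd.
by move=> y; rewrite /difference !hh subrr.
Qed.

Lemma diff_order_lt_leq d e h : (d <= e)%N -> diff_order_lt d h -> diff_order_lt e h.
Proof.
elim: e => [|e IHe]; first by rewrite leqn0 => /eqP ->.
by rewrite leq_eqVlt => /orP[/eqP -> //|/IHe de] /de; apply: diff_order_ltS.
Qed.

(** The induction runs on a bound [s] of [d + e]: every term of the product rule, including the
    extra product of the two differences, lowers [d] or [e]. *)
Lemma diff_order_ltM s d e f g : (d + e <= s)%N ->
  diff_order_lt d f -> diff_order_lt e g -> diff_order_lt s (f \* g).
Proof.
elim: s d e f g => [|s IHs] d e f g des hf hg.
  by move: des hf; rewrite leqn0 addn_eq0 => /andP[/eqP -> _] hf y; rewrite /= hf mul0r.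
case: d des hf => [|d] des hf.
  by apply: diff_order_lt0 => y; rewrite /= hf mul0r.
case: e des hg => [|e] des hg.
  by apply: diff_order_lt0 => y; rewrite /= hg mulr0.
move=> v; rewrite (_ : difference v _ = (difference v f \* g \+
   f \* difference v g) \+ difference v f \* difference v g).
  apply: diff_order_ltD; first apply: diff_order_ltD.
  - by apply: (IHs d e.+1).
  - by apply: (IHs d.+1 e) => //; rewrite addSnnS.
  - by apply: (IHs d e) => //; rewrite ltnW // -addnS.
by apply/funext => y; rewrite /difference /=; ring.
Qed.

Lemma diff_order_subalg : is_subalgebra [set h | exists d, diff_order_lt d h].
Proof.
split.
- by move=> c; exists 1%N => v y; rewrite /difference subrr.
- move=> f g [d hf] [e hg]; exists (maxn d e); apply: diff_order_ltD.
    exact: diff_order_lt_leq (leq_maxl _ _) hf.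
  exact: diff_order_lt_leq (leq_maxr _ _) hg.
- move=> f g [d hf] [e hg]; exists (d + e)%N.
  exact: (diff_order_ltM (leqnn _) hf hg).
Qed.

End Differences.

Lemma diff_order_meval (k : fieldType) n (p : {mpoly k[n]}) :
  exists d, diff_order_lt (fun v w : 'rV[k]_n => v + w) d
              (fun w : 'rV[k]_n => p.@[w 0]).
Proof.
apply: (subalgebra_meval (h := fun i (w : 'rV[k]_n) => w 0 i) p
  (diff_order_subalg (fun v w : 'rV[k]_n => v + w))) => i.
by exists 2%N => v w y; rewrite /difference !mxE !addrK subrr.
Qed.

(** Along an orbit, a difference of [h] amounts to a difference of each coefficient [q t]. *)
Lemma diff_order_expand (k : fieldType) n (Y : Type) (a : 'rV[k]_n -> Y -> Y) N
    (q : 'I_N -> 'rV[k]_n -> k) (b : 'I_N -> Y -> k) (h : Y -> k) d :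
  (forall v w y, a (v + w) y = a v (a w y)) -> (forall y, a 0 y = y) ->
  (forall t, diff_order_lt (fun v w : 'rV[k]_n => v + w) d (q t)) ->
  (forall v y, h (a v y) = \sum_t q t v * b t y) -> diff_order_lt a d h.
Proof.
move=> aD a0; elim: d q h => [|d IHd] q h hq hE.
  by move=> y; rewrite -[y]a0 hE big1 // => t _; rewrite hq mul0r.
move=> w; apply: (IHd (fun t => difference (fun v w => v + w) w (q t))) => [t|v y].
  exact: hq.
rewrite /difference -aD !hE -sumrB; apply: eq_bigr => t _; exact: esym (mulrBl _ _ _).
Qed.

(** Take a matrix of maximal rank among those with rows in [W]: adjoining a vector of [W] cannot
    raise its rank. *)
Lemma subspace_row_space (k : fieldType) n (W : set 'rV[k]_n) :
  W 0 -> (forall c u v, W u -> W v -> W (c *: u + v)) ->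
  exists M : 'M[k]_n, forall c, (c <= M)%MS <-> W c.
Proof.
move=> W0 WD.
have sub (M : 'M[k]_n) : (forall i, W (row i M)) -> forall c, (c <= M)%MS -> W c.
  move=> WM c /submxP[u ->]; rewrite mulmx_sum_row.
  by elim/big_rec: _ => // i v _ Wv; apply: WD.
pose P (r : nat) := `[< exists2 M : 'M[k]_n, (forall i, W (row i M)) & \rank M = r >].
have P0 : P 0%N.
  by apply/asboolP; exists 0; rewrite ?mxrank0 // => i; rewrite row0.
have Ple r : P r -> (r <= n)%N by move=> /asboolP[M _ <-]; apply: rank_leq_row.
case: (ex_maxnP (ex_intro (fun r => is_true (P r)) 0%N P0) Ple) => r /asboolP[M WM rM] maxr.
exists M => c; split=> [|Wc]; first exact: sub.
pose M' := <<col_mx c M>>%MS.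
have sM' : (M <= M')%MS by rewrite genmxE -addsmxE addsmxSr.
have sc : (c <= M')%MS by rewrite genmxE -addsmxE addsmxSl.
have WM' i : W (row i M').
  have : (row i M' <= c + M)%MS.
    by rewrite (submx_trans (row_sub i M')) // genmxE addsmxE.
  move=> /sub_addsmxP[[u v] /= ->].
  rewrite [u]mx11_scalar mul_scalar_mx; apply: WD => //.
  by apply: sub WM _ _; apply: submxMl.
have : (\rank M' <= \rank M)%N by rewrite rM maxr //; apply/asboolP; exists M'.
by rewrite (geq_leqif (mxrank_leqif_sup sM')) => /(submx_trans sc).
Qed.

(** * Finite-valued regular functions on a connected variety *)

Section FiniteValues.
Variables (k : closedFieldType) (X : affine_variety k).

Lemma zariski_closed_zeros (p : {mpoly k[ambient_dim X]}) :
  zariski_closed [set z | locus X z /\ p.@[z 0] = 0].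
Proof.
have [I XI] := locus_closed X; exists (I `|` [set p]).
apply/seteqP; split=> [z [] + pz r [Ir|->] //|z /= hz].
  by rewrite XI => /(_ r Ir).
by split; [rewrite XI => r Ir|]; apply: hz; [left|right].
Qed.

(** The zero sets of [f - f x] and of the product of the [f - r], over the other roots [r] of [p],
    are closed, disjoint and cover [X]. Both are nonempty if [f y] differs from [f x]. *)
Lemma connected_finite_values (f : X -> k) (p : {poly k}) :
  zariski_connected (locus X) -> chart_functions setT (fun x : X => val x) f ->
  p != 0 -> (forall x, p.[f x] = 0) -> forall x y, f x = f y.
Proof.
move=> Xconn [P fP] pN0 pf x y; apply/eqP/negPn/negP => fxy.
have [s ps] := closed_field_poly_normal p.
have fs z : f z \in s.
  have := pf z; rewrite ps hornerZ => /eqP; rewrite mulf_eq0 lead_coef_eq0 (negbTE pN0) /=.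
  by rewrite -rootE root_prod_XsubC.
pose Q := \prod_(r <- s | r != f x) (P - r%:MP).
have QE z : Q.@[z] = \prod_(r <- s | r != f x) (P.@[z] - r).
  by rewrite rmorph_prod; apply: eq_bigr => r _; rewrite /= mevalB mevalC.
pose Y : set 'rV[k]_(ambient_dim X) := [set z | locus X z /\ (P - (f x)%:MP).@[z 0] = 0].
pose Z : set 'rV[k]_(ambient_dim X) := [set z | locus X z /\ Q.@[z 0] = 0].
have Q0 (z : X) : f z != f x -> Q.@[val z 0] = 0.
  move=> zx; rewrite QE; apply/eqP; rewrite prodf_seq_eq0; apply/hasP.
  by exists (f z); rewrite ?fs // zx -fP // subrr eqxx.
have [||YZ|YZ] := Xconn Y Z (zariski_closed_zeros _) (zariski_closed_zeros _).
- apply/seteqP; split=> [z Xz|z [] []] //.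
  pose z' : X := SigSub (mem_set Xz).
  have [E|/Q0 /= zx] := eqVneq (f z') (f x); last by right.
  by left; split=> //; rewrite mevalB mevalC -E (fP z') // subrr.
- apply/seteqP; split=> // z [[_ /eqP]]; rewrite mevalB mevalC subr_eq0 => /eqP Pz [_].
  rewrite QE Pz => /eqP; rewrite prodf_seq_eq0 => /hasP[r _ /andP[rx]].
  by rewrite subr_eq0 eq_sym (negbTE rx).
- suff : set0 (val x) by [].
  rewrite -YZ; split; first exact: set_valP.
  by rewrite mevalB mevalC fP // subrr.
- suff : set0 (val y) by [].
  by rewrite -YZ; split; [exact: set_valP|apply: Q0; rewrite eq_sym].
Qed.

End FiniteValues.

Lemma row_mulmx_tr (R : comPzRingType) m n (Q : 'M[R]_(m, n)) i (v : 'rV[R]_n) :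
  (row i Q *m v^T) 0 0 = (v *m Q^T) 0 i.
Proof. by rewrite !mxE; apply: eq_bigr => j _; rewrite !mxE mulrC. Qed.

(** * Self-centralizing actions of the vector group and their invariants *)

Section VectorGroupAction.
Variables (k : closedFieldType) (n : nat) (X : affine_variety k).
Variable a : 'rV[k]_n -> X -> X.
Local Notation m := (ambient_dim X).
Local Notation regular := (chart_functions setT (fun x : X => val x)).

Hypothesis k_char0 : [pchar k] =i pred0.
Hypothesis act0 : forall x, a 0 x = x.
Hypothesis actD : forall v w x, a (v + w) x = a v (a w x).
(** Algebraicity of the action is kept as a finite sum of products: differences in [v] then affect
    the [q t] alone. *)
Variables (N : nat) (q : 'I_N -> {mpoly k[n]}) (b : 'I_N -> 'I_m -> {mpoly k[m]}).
Hypothesis actE : forall v x j,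
  val (a v x) 0 j = \sum_t (q t).@[v 0] * (b t j).@[val x 0].

Let actC v w x : a v (a w x) = a w (a v x).
Proof. by rewrite -!actD addrC. Qed.

Let regularA : is_subalgebra regular.
Proof. exact: chart_functions_subalg. Qed.

Lemma point_eqP (x y : X) : (forall j, val x 0 j = val y 0 j) -> x = y.
Proof. by move=> xy; apply/val_inj/rowP. Qed.

Lemma regular_const c : regular (fun=> c).
Proof. by exists c%:MP => x _; rewrite mevalC. Qed.

Lemma regular_coord j : regular (fun x => val x 0 j).
Proof. exact: chart_functions_coord. Qed.

(** [R] stays arbitrary in order to serve for regular functions, for polynomials in one parameter
    and for functions of finite difference order. *)
Lemma subalgebra_regular (T : Type) (R : set (T -> k)) (y : T -> X) f :
  is_subalgebra R -> (forall j, R (fun t => val (y t) 0 j)) -> regular f ->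
  R (fun t => f (y t)).
Proof.
move=> RA Ry [p fp]; rewrite (_ : (fun _ => _) = fun t => p.@[(fun j t => val (y t) 0 j)^~ t]).
  exact: subalgebra_meval.
by apply/funext => t; rewrite fp.
Qed.

Lemma subalgebra_act (T : Type) (R : set (T -> k)) (u : T -> 'rV[k]_n) (y : T -> X) :
  is_subalgebra R -> (forall i, R (fun t => u t 0 i)) ->
  (forall j, R (fun t => val (y t) 0 j)) ->
  forall j, R (fun t => val (a (u t) (y t)) 0 j).
Proof.
move=> RA Ru Ry j; have [_ _ RM] := RA.
rewrite (_ : (fun _ => _) =
   fun s => \sum_t ((fun s => (q t).@[(fun i s => u s 0 i)^~ s]) \*
                    (fun s => (b t j).@[(fun j s => val (y s) 0 j)^~ s])) s).
  by apply: subalgebra_sum => // t; apply: RM; apply: subalgebra_meval.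
by apply/funext => t; rewrite actE.
Qed.

Lemma regular_act v f : regular f -> regular (f \o a v).
Proof.
apply: subalgebra_regular => //; apply: (@subalgebra_act _ _ (fun=> v) id) => // [i|j].
  exact: regular_const.
exact: regular_coord.
Qed.

Lemma regular_difference v f : regular f -> regular (difference a v f).
Proof. by move=> rf; apply: subalgebra_sub => //; apply: regular_act. Qed.

(** Unipotence of the vector group: the orders of the finitely many [q t] bound those of the
    coordinates, and functions of finite order form an algebra. *)
Lemma regular_diff_order f : regular f -> exists d, diff_order_lt a d f.
Proof.
have DA := diff_order_subalg a.
apply: (@subalgebra_regular _ [set h | exists d, diff_order_lt a d h] id) => // j /=.
have [d hd] := choice (fun t => diff_order_meval (q t)).
exists (\max_t d t)%N.
apply: (@diff_order_expand _ _ _ a N (fun t v => (q t).@[v 0])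
  (fun t x => (b t j).@[val x 0])) => // [t|v y]; last exact: actE.
exact: diff_order_lt_leq (leq_bigmax t) (hd t).
Qed.

(** If some difference of [f] is nonzero, it has lower order and still vanishes on the stable set
    [Y]; otherwise [f] itself is invariant. *)
Lemma nonzero_invariant (Y : set X) f d :
  (forall v y, Y y -> Y (a v y)) ->
  regular f -> diff_order_lt a d f -> (forall y, Y y -> f y = 0) ->
  (exists x, f x <> 0) ->
  exists g, [/\ regular g, forall y, Y y -> g y = 0,
                exists x, g x <> 0 & forall v x, g (a v x) = g x].
Proof.
move=> aY; elim: d f => [|d IHd] f rf hf Yf [x fx]; first by have := hf x.
have [[v vN0]|h] := pselect (exists v x, difference a v f x <> 0).
  apply: (IHd (difference a v f)) => // [|y Yy]; first exact: regular_difference.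
  by rewrite /difference !Yf ?subrr //; apply: aY.
exists f; split=> //; first by exists x.
move=> v y; apply/eqP; rewrite -subr_eq0; apply/eqP; apply: contrapT => fvy.
by apply: h; exists v, y.
Qed.

(** That [t *: u] fixes [x] is a polynomial condition on [t], and it holds for all natural
    numbers. *)
Lemma stabilizer_lin x c u v : a u x = x -> a v x = x -> a (c *: u + v) x = x.
Proof.
move=> ux vx; rewrite actD vx; apply: point_eqP => j.
apply/eqP; rewrite -subr_eq0; apply/eqP; move: c.
apply: univariate_eq0 => // [|i].
  have UA := univariate_functions_subalg k.
  apply: subalgebra_sub => //; last exact: univariate_const.
  apply: (@subalgebra_act _ _ (fun t => t *: u) (fun=> x)) => // [i|i];
    last exact: univariate_const.
  rewrite (_ : (fun _ => _) = fun t => t * u 0 i); first exact: univariate_scale.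
  by apply/funext => t; rewrite mxE.
suff -> : a (i%:R *: u) x = x by rewrite subrr.
elim: i => [|i IHi]; first by rewrite scale0r act0.
by rewrite -natr1 scalerDl scale1r actD ux.
Qed.

Hypothesis n_gt0 : (0 < n)%N.
Hypothesis act_faithful : forall v, (forall x, a v x = x) -> v = 0.
Hypothesis act_selfcentral : forall g : automorphism X,
  (forall v x, aut_fun g (a v x) = a v (aut_fun g x)) ->
  exists c, forall x, aut_fun g x = a c x.
Hypothesis X_connected : zariski_connected (locus X).

(** As [f] is invariant, the twist by [- f] is the inverse, and the twist commutes with the
    commutative group acting. *)
Lemma invariant_twist f w : regular f -> (forall v x, f (a v x) = f x) ->
  exists c, forall x, a (f x *: w) x = a c x.
Proof.
move=> rf fa.
have mor h : regular h -> is_morphism (fun x => a (h x *: w) x).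
  move=> rh.
  have [j|P hP] := @choice 'I_m {mpoly k[m]}
    (fun j p => forall x : X, val (a (h x *: w) x) 0 j = p.@[val x 0]).
    have [i|i|p hp] := @subalgebra_act X regular (fun x => h x *: w) id regularA _ _ j.
    - rewrite (_ : (fun _ => _) = fun x => h x * w 0 i); first exact: subalgebra_scale.
      by apply/funext => x; rewrite mxE.
    - exact: regular_coord.
    - by exists p => x; apply: hp.
  by exists P => x j; apply: hP.
have rfN : regular (fun x => - f x).
  rewrite (_ : (fun _ => _) = fun x => f x * -1); first exact: subalgebra_scale.
  by apply/funext => x; rewrite mulrN1.
have fK : cancel (fun x => a (f x *: w) x) (fun x => a (- f x *: w) x).
  by move=> x; rewrite fa -actD scaleNr addNr act0.
have fNK : cancel (fun x => a (- f x *: w) x) (fun x => a (f x *: w) x).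
  by move=> x; rewrite fa -actD scaleNr addrN act0.
apply: (act_selfcentral (g := Automorphism (mor f rf) (mor _ rfN) fK fNK)) => v x /=.
by rewrite fa actC.
Qed.

(** The rows of [M] are the vectors [c i], so each row of [M - f x] fixes [x]. If [f x] were not an
    eigenvalue, these rows would span [k^n] and all of [k^n] would fix [x]. *)
Lemma invariant_algebraic f : regular f -> (forall v x, f (a v x) = f x) ->
  exists2 p : {poly k}, p != 0 & forall x, (exists w, a w x <> x) -> p.[f x] = 0.
Proof.
move=> rf fa.
have [c hc] := choice (fun i : 'I_n => invariant_twist (delta_mx 0 i) rf fa).
pose M := \matrix_i c i.
exists (char_poly M); first by rewrite monic_neq0 // char_poly_monic.
move=> x [w wx]; apply/eqP; rewrite -[_ == 0]eigenvalue_root_char.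
rewrite /eigenvalue kermx_eq0 row_free_unit; apply/negP => Mu; apply: wx.
rewrite -[w](mulmxKV Mu) mulmx_sum_row.
elim/big_rec: _ => [|i u _ ux]; first exact: act0.
apply: stabilizer_lin ux; rewrite linearB /= rowK -scalemx1 linearZ /= row1.
have := hc i x; move=> /(congr1 (a (- (f x *: delta_mx 0 i)))).
by rewrite -!actD addNr act0 addrC => <-.
Qed.

Lemma act_nontrivial : exists x w, a w x <> x.
Proof.
apply: contrapT => h.
have /rowP/(_ (Ordinal n_gt0)) : const_mx 1 = 0 :> 'rV[k]_n.
  apply: act_faithful => x; apply: contrapT => hx.
  by apply: h; exists x, (const_mx 1).
by rewrite !mxE => /eqP; rewrite oner_eq0.
Qed.

Lemma invariant_constant f : regular f -> (forall v x, f (a v x) = f x) ->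
  forall x y, f x = f y.
Proof.
move=> rf fa; have [x1 [w1 wx1]] := act_nontrivial.
pose F : set X := [set x | forall w, a w x = x].
have Fa v y : F y -> F (a v y) by move=> Fy w; rewrite !Fy.
have [j wxj] : exists j, val (a w1 x1) 0 j <> val x1 0 j.
  apply: contrapT => h; apply: wx1; apply: point_eqP => j.
  by apply: contrapT => hj; apply: h; exists j.
(* This function vanishes at the fixed points but not at [x1]. *)
pose h := difference a w1 (fun x => val x 0 j).
have rh : regular h by apply: regular_difference; apply: regular_coord.
have [d hd] := regular_diff_order rh.
have [||g [rg Fg [z gz] ga]] := nonzero_invariant Fa rh hd.
- by move=> y Fy; rewrite /h /difference Fy subrr.
- by exists x1 => /eqP; rewrite /h /difference subr_eq0 => /eqP.
have [p pN0 pg] := invariant_algebraic rg ga.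
have gconst : forall x y, g x = g y.
  (* The factor ['X] accounts for the fixed points, where [g] is 0, and [p] for all other points. *)
  apply: (@connected_finite_values _ _ _ ('X * p)) => // [|x].
    by rewrite mulf_neq0 ?polyX_eq0.
  have [/pg gx|Fx] := pselect (exists w, a w x <> x).
    by rewrite hornerM gx mulr0.
  rewrite hornerM hornerX Fg ?mul0r // => w; apply: contrapT => wx.
  by apply: Fx; exists w.
have [r rN0 rf0] := invariant_algebraic rf fa.
apply: (@connected_finite_values _ _ _ r) => // x; apply: rf0.
(* A fixed point would force the constant [g] to be 0. *)
apply: contrapT => Fx; apply: gz; rewrite (gconst z x); apply: Fg => w.
by apply: contrapT => wx; apply: Fx; exists w.
Qed.

(** Otherwise there would be a nonzero invariant vanishing on [Y], yet invariants are constant. *)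
Lemma stable_dense (Y : set X) y0 f : (forall v y, Y y -> Y (a v y)) -> Y y0 ->
  regular f -> (forall y, Y y -> f y = 0) -> forall x, f x = 0.
Proof.
move=> aY Yy0 rf Yf x; apply: contrapT => fx.
have [d hd] := regular_diff_order rf.
have [g [rg Yg [z gz] ga]] := nonzero_invariant aY rf hd Yf (ex_intro _ x fx).
by apply: gz; rewrite (invariant_constant rg ga z y0) Yg.
Qed.


(** * Density and freeness of an orbit, and its linear coordinates *)

Section Orbit.
Variable x0 : X.

Lemma orbit_dense f g : regular f -> regular g ->
  (forall v, f (a v x0) = g (a v x0)) -> f =1 g.
Proof.
move=> rf rg fg x; apply/eqP; rewrite -subr_eq0; apply/eqP; move: x.
apply: (@stable_dense (range (a^~ x0)) x0).
- by move=> v _ [w _ <-]; exists (v + w); rewrite ?actD.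
- by exists 0; rewrite ?act0.
- exact: subalgebra_sub.
- by move=> _ [v _ <-]; rewrite fg subrr.
Qed.

(** By commutativity [u] fixes the whole orbit, so by density it acts trivially on [X]. *)
Lemma orbit_free u : a u x0 = x0 -> u = 0.
Proof.
move=> ux0; apply: act_faithful => x; apply: point_eqP => j; move: x.
apply: (orbit_dense (f := fun x => val (a u x) 0 j)).
- exact: (regular_act u (regular_coord j)).
- exact: regular_coord.
- by move=> v; rewrite actC ux0.
Qed.

Lemma univariate_orbit h v : regular h -> univariate_functions (fun t => h (a (t *: v) x0)).
Proof.
have UA := univariate_functions_subalg k.
apply: subalgebra_regular => //.
apply: (@subalgebra_act _ _ (fun t => t *: v) (fun=> x0)) => // [i|i];
  last exact: univariate_const.
rewrite (_ : (fun _ => _) = fun t => t * v 0 i); first exact: univariate_scale.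
by apply/funext => t; rewrite mxE.
Qed.

(** Additivity gives homogeneity for natural multiples; it extends to all [t] because both sides are
    polynomial in [t]. *)
Lemma additive_orbit_linear h : regular h ->
  (forall v w, h (a (v + w) x0) = h (a v x0) + h (a w x0)) ->
  exists c : 'rV[k]_n, forall v, h (a v x0) = (c *m v^T) 0 0.
Proof.
move=> rh hD.
have h0 : h (a 0 x0) = 0.
  by apply: (addrI (h (a 0 x0))); rewrite -hD !addr0.
have hZ t v : h (a (t *: v) x0) = t * h (a v x0).
  apply/eqP; rewrite -subr_eq0; apply/eqP; move: t.
  apply: univariate_eq0 => // [|i].
    have UA := univariate_functions_subalg k.
    apply: subalgebra_sub => //; first exact: univariate_orbit.
    exact: univariate_scale.
  elim: i => [|i IHi]; first by rewrite scale0r h0 mul0r subrr.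
  rewrite -natr1 scalerDl scale1r hD mulrDl mul1r opprD addrACA subrr addr0.
  exact: IHi.
exists (\row_i h (a (delta_mx 0 i) x0)) => v.
have sumD (r : seq 'I_n) : h (a (\sum_(i <- r) v 0 i *: delta_mx 0 i) x0) =
    \sum_(i <- r) v 0 i * h (a (delta_mx 0 i) x0).
  by elim: r => [|i r IH]; rewrite ?big_nil ?h0 // !big_cons hD hZ IH.
rewrite {1}(row_sum_delta v) sumD mxE; apply: eq_bigr => i _.
by rewrite !mxE mulrC.
Qed.

Let linear_on_orbit (c : 'rV[k]_n) :=
  exists2 s, regular s & forall v, s (a v x0) = (c *m v^T) 0 0.

Lemma orbit_coordinates : exists s : 'I_n -> X -> k,
  (forall i, regular (s i)) /\ forall v i, s i (a v x0) = v 0 i.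
Proof.
have [Rc RD RM] := regularA.
have [||M hM] := @subspace_row_space k n [set c | linear_on_orbit c].
- by exists (cst 0) => // v; rewrite mul0mx mxE.
- move=> c u v [s rs su] [r rr rv]; exists (fun x => s x * c + r x).
    by apply: (RD (fun x => s x * c)) => //; apply: subalgebra_scale.
  by move=> w; rewrite su rv mulmxDl -scalemxAl !mxE mulrC.
(* The projection [pi] has for components the linear forms in the row space of
   [Q], which are restrictions of regular functions to the orbit. If the
   differences of [h] factor through [pi], then [h - h \o pi] is additive, so it
   is a linear form of this kind; as it vanishes on the image of [pi], it is 0. *)
pose Q := pinvmx M *m M.
have QE c : linear_on_orbit c -> c *m Q = c.
  by move=> /hM cM; rewrite mulmxA mulmxKpV.
have MQ : M *m Q = M by rewrite mulmxA mulmxKpV.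
have QQ : Q *m Q = Q by rewrite {1}/Q -mulmxA MQ.
pose pi (v : 'rV[k]_n) := v *m Q^T.
have pi_id v : pi (pi v) = pi v by rewrite /pi -mulmxA -trmx_mul QQ.
have [s hs] := @choice 'I_n (X -> k) (fun i s => regular s /\
    forall v, s (a v x0) = pi v 0 i) (fun i =>
    let: ex_intro2 s rs sE := (hM (row i Q)).1 (submx_trans (row_sub i Q) (submxMl _ _)) in
    ex_intro _ s (conj rs (fun v => etrans (sE v) (row_mulmx_tr Q i v)))).
pose S x : 'rV[k]_n := \row_i s i x.
have SE v : S (a v x0) = pi v by apply/rowP => i; rewrite mxE (hs i).2.
have main d : forall h, regular h -> diff_order_lt a d h ->
    forall v, h (a v x0) = h (a (pi v) x0).
  elim: d => [|d IHd] h rh hd; first by move=> v; rewrite !hd.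
  pose H v := h (a v x0).
  have IH v w : H (v + w) - H v = H (pi v + w) - H (pi v).
    have := IHd _ (regular_difference w rh) (hd w) v.
    by rewrite /difference /H -!actD ![w + _]addrC.
  (* [S] extends [pi] from the orbit to [X], so [g] is a regular extension of [H - H \o pi]. *)
  pose g x := h x - h (a (S x) x0).
  have rg : regular g.
    apply: subalgebra_sub => //; apply: subalgebra_regular => //.
    apply: (@subalgebra_act _ _ S (fun=> x0)) => // [i|i]; last exact: regular_const.
    rewrite (_ : (fun _ => _) = s i); first exact: (hs i).1.
    by apply/funext => x; rewrite mxE.
  have gE v : g (a v x0) = H v - H (pi v) by rewrite /g SE.
  have [v w|c cE] := additive_orbit_linear rg.
    rewrite !gE /pi mulmxDl -/(pi v) -/(pi w).
    (* The first instance replaces [v] by [pi v] in [H (v + w)], the second then replaces [w] by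
       [pi w]. *)
    have := IH v w; have := IH w (pi v); rewrite [w + _]addrC [pi w + _]addrC.
    move: (H (v + w)) (H v) (H (pi v + w)) (H (pi v)) (H w) (H (pi v + pi w)) (H (pi w)).
    move=> e1 e2 e3 e4 e5 e6 e7 E1 E2.
    by rewrite -[e1](subrK e2) E2 -[e3](subrK e5) E1; ring.
  have cQ : c *m Q = c by apply: QE; exists g.
  move=> v; have := gE v; rewrite cE -cQ.
  have -> : c *m Q *m v^T = c *m (pi v)^T by rewrite -(mulmxA c Q) /pi trmx_mul trmxK.
  by rewrite -cE gE pi_id subrr => /esym/eqP; rewrite subr_eq0 => /eqP.
exists s; split=> [i|v i]; first exact: (hs i).1.
(* Applied to the coordinates of [X], [main] shows that [v] and [pi v] send [x0] to the same point;
   freeness then gives equality. *)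
rewrite (hs i).2; suff -> : pi v = v by [].
apply/eqP; rewrite -subr_eq0 addrC; apply/eqP; apply: orbit_free.
have -> : a (- v + pi v) x0 = a (- v) (a v x0).
  rewrite actD; congr (a _ _); apply: point_eqP => j.
  have rj := regular_coord j; have [d hd] := regular_diff_order rj.
  by rewrite -(main d _ rj hd).
by rewrite -actD addNr act0.
Qed.

End Orbit.

Lemma selfcentral_vector_group_action : variety_iso X (affine_space k n).
Proof.
have [x0 _] := act_nontrivial.
have [s [rs sE]] := orbit_coordinates x0.
pose S x : 'rV[k]_n := \row_i s i x.
have SE v : S (a v x0) = v by apply/rowP => i; rewrite mxE sE.
pose phi (x : X) : affine_space k n := SigSub (mem_set (I : setT (S x))).
pose psi (v : affine_space k n) : X := a (val v) x0.
exists phi, psi; split.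
- have [P hP] := choice rs; exists P => x j.
  by rewrite mxE hP.
- exists (fun j => \sum_t (b t j).@[val x0 0] *: q t) => v j.
  by rewrite actE raddf_sum; apply: eq_bigr => t _; rewrite /= mevalZ mulrC.
(* Both sides are regular and agree on the dense orbit of [x0]. *)
- move=> x; apply: point_eqP => j; move: x.
  apply: (orbit_dense (x0 := x0) (g := fun x => val x 0 j)).
  + apply: (@subalgebra_act _ _ S (fun=> x0)) => // [i|i]; last exact: regular_const.
    rewrite (_ : (fun _ => _) = s i) //.
    by apply/funext => x; rewrite mxE.
  + exact: regular_coord.
  + by move=> v; rewrite /psi /= SE.
- by move=> v; apply: val_inj; rewrite /= SE.
Qed.

End VectorGroupAction.

(** * Translations inside the automorphism group of affine space *)

Section Translations.
Variables (k : fieldType) (n : nat).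

Definition affine_point (v : 'rV[k]_n) : affine_space k n := SigSub (mem_set (I : setT v)).

Definition translate (v : 'rV[k]_n) (x : affine_space k n) : affine_space k n :=
  affine_point (val x + v).

Lemma translate_morphism v : is_morphism (translate v).
Proof. by exists (fun j => 'X_j + (v 0 j)%:MP) => x j; rewrite mxE mevalD mevalXU mevalC. Qed.

Lemma translateK v w : v + w = 0 -> cancel (translate v) (translate w).
Proof. by move=> vw x; apply: val_inj; rewrite /= -addrA vw addr0. Qed.

Definition translation v : automorphism (affine_space k n) := Automorphism
  (translate_morphism v) (translate_morphism (- v))
  (translateK (addrN v)) (translateK (addNr v)).

Lemma translationD v w : translation (v + w) = (translation v * translation w)%g.
Proof. by apply: automorphism_eq => x; apply: val_inj; rewrite /= [v + w]addrC addrA. Qed.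

Lemma translation_inj : injective translation.
Proof.
move=> v w /(congr1 (fun g => val (aut_fun g (affine_point 0)))) /=.
by rewrite !add0r.
Qed.

(** Commutation with the translation by [x], evaluated at the origin, gives [g x = g 0 + x]. *)
Lemma translation_selfcentral (g : automorphism (affine_space k n)) :
  (forall v, translation v * g = g * translation v)%g ->
  g = translation (val (aut_fun g (affine_point 0))).
Proof.
move=> gC; apply: automorphism_eq => x; apply: val_inj => /=.
have := congr1 (fun h => val (aut_fun h (affine_point 0))) (gC (val x)).
rewrite /= addrC => ->; congr (val (aut_fun g _)).
by apply: val_inj; rewrite /= add0r.
Qed.

(** The dependence on [v] is affine, hence any linear form of the pair is polynomial in [v]; the
    minus sign comes from the inverse. *)
Lemma aut_pair_translation v : aut_pair (translation v) =
  aut_pair (translation 0) + \sum_i v 0 i *: (fun=> row_mx (delta_mx 0 i) (- delta_mx 0 i)).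
Proof.
apply/funext => x; apply/rowP => j; rewrite pw_D pw_sum.
under eq_bigr do rewrite pw_Z.
case: (split_ordP j) => i ->.
  rewrite !aut_pair_lshift /= !mxE addr0 (bigD1 i) //= big1 ?addr0 => [|i' ii'].
    by rewrite row_mxEl mxE !eqxx mulr1.
  by rewrite row_mxEl mxE eq_sym (negbTE ii') andbF mulr0.
rewrite !aut_pair_rshift /= !mxE oppr0 addr0 (bigD1 i) //= big1 ?addr0 => [|i' ii'].
  by rewrite row_mxEr !mxE !eqxx mulrN1.
by rewrite row_mxEr !mxE eq_sym (negbTE ii') andbF oppr0 mulr0.
Qed.

Lemma aut_fil_translation v : aut_fil 1 (translation v).
Proof.
move=> j; case: (split_ordP j) => i ->.
  exists ('X_i + (v 0 i)%:MP) => [|x].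
    by apply: msizeD_bound; rewrite ?msizeX ?mdeg1 // msizeC (leq_trans (leq_b1 _)).
  by rewrite aut_pair_lshift mevalD mevalXU mevalC /= mxE.
exists ('X_i + (- v 0 i)%:MP) => [|x].
  by apply: msizeD_bound; rewrite ?msizeX ?mdeg1 // msizeC (leq_trans (leq_b1 _)).
by rewrite aut_pair_rshift mevalD mevalXU mevalC /= !mxE.
Qed.

Lemma aut_reg_translation d f : (0 < d)%N -> aut_reg d f ->
  exists p : {mpoly k[n]}, forall v, f (translation v) = p.@[v 0].
Proof.
move=> d0 [F hF fF].
suff [p hp] : chart_functions setT id (fun v => F (aut_pair (translation v))).
  exists p => v; rewrite fF ?hp //.
  exact: regular_maps_le_leq d0 _ (aut_fil_translation v).
move: F hF {f fF}; apply: generated_algebra_ind.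
  have [Cc CD CM] := @chart_functions_subalg k 'rV[k]_n n setT id.
  by split=> [c|F G|F G]; [apply: Cc|apply: CD|apply: CM].
move=> l ll /=.
exists ((l (aut_pair (translation 0)))%:MP + \sum_i
  l (fun=> row_mx (delta_mx 0 i) (- delta_mx 0 i)) *: 'X_i) => v _.
rewrite aut_pair_translation addrC -[\sum_i _]scale1r ll mul1r scalar_sum // addrC.
rewrite mevalD mevalC raddf_sum; congr (_ + _); apply: eq_bigr => i _.
by rewrite /= mevalZ mevalXU mulrC.
Qed.

End Translations.

(** All translations lie in the first filtration piece, so their images lie in one piece [e].
    Expanding these images in finitely many maps of bounded degree gives coefficients that are
    regular, hence polynomial in [v]. *)
Lemma translation_action_polynomial (k : fieldType) (n : nat) (X : affine_variety k)
    (psi : aut_ind_group (affine_space k n) -> aut_ind_group X) :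
  is_ind_morphism (aut_structure (affine_space k n)) (aut_structure X) psi ->
  exists (N : nat) (q : 'I_N -> {mpoly k[n]})
         (b : 'I_N -> 'I_(ambient_dim X) -> {mpoly k[ambient_dim X]}),
    forall v x j, val (aut_fun (psi (translation v)) x) 0 j =
                  \sum_t (q t).@[v 0] * (b t j).@[val x 0].
Proof.
move=> psim; have [e [psi_fil psi_reg]] := psim 1%N.
set m := ambient_dim X.
have [N [b [s [bW bE]]]] := regular_maps_expand X (m + m) e.
have [q hq] := choice (fun t => aut_reg_translation (ltn0Sn 0)
  (psi_reg _ (aut_reg_scalar e (eval_comb_scalar (s t))))).
have [B hB] := choice (fun tj : 'I_N * 'I_m =>
  let: ex_intro2 p _ hp := bW tj.1 (lshift m tj.2) in ex_intro
   (fun p : {mpoly k[m]} => forall x : X, b tj.1 x 0 (lshift m tj.2) = p.@[val x 0]) p hp).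
exists N, q, (fun t j => B (t, j)) => v x j.
rewrite -aut_pair_lshift (bE _ (psi_fil _ (aut_fil_translation v))) pw_sum.
by apply: eq_bigr => t _; rewrite pw_Z -hq -(hB (t, j)).
Qed.

Theorem theorem1p1 (k : closedFieldType) (k_char0 : [pchar k] =i pred0)
    (n : nat) (n_ge1 : (1 <= n)%N)
    (X : affine_variety k) (X_connected : zariski_connected (locus X)) :
  ind_group_iso (aut_ind_group X) (aut_ind_group (affine_space k n)) ->
  variety_iso X (affine_space k n).
Proof.
move=> [phi [psi [phiM phiK psiK _ psim]]].
have psiM : {morph psi : x y / (x * y)%g}.
  by move=> x y; apply: (can_inj phiK); rewrite phiM !psiK.
have [N [q [b actE]]] := translation_action_polynomial psim.
pose a v : X -> X := aut_fun (psi (translation v)).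
have aD v w x : a (v + w) x = a v (a w x).
  by rewrite /a translationD psiM.
have a0 x : a 0 x = x.
  (* By [aD], [a 0] is idempotent, and it is injective. *)
  by apply: (can_inj (aut_funK (psi (translation 0)))); rewrite -[LHS]aD addr0.
apply: (selfcentral_vector_group_action (a := a) k_char0 a0 aD actE n_ge1) => // [v av|g ga].
  apply: (@translation_inj k n); apply: (can_inj psiK); apply: automorphism_eq => x.
  by rewrite -/(a v x) -/(a 0 x) av a0.
(* Self-centrality is carried over: [phi g] commutes with all translations, hence is one. *)
have phig : phi g = translation (val (aut_fun (phi g) (affine_point 0))).
  apply: translation_selfcentral => v; apply: (can_inj psiK).
  rewrite !psiM phiK; apply: automorphism_eq => x; exact: esym (ga v x).
by exists (val (aut_fun (phi g) (affine_point 0))) => x; rewrite /a -phig phiK.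
Qed.
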